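(* Fix a distribution-labeled $k$-graph $G=(\mathcal V,\mathcal E,N,(\mu_{\mathsf e})_{\mathsf e\in\mathcal E})$, an integer $K>0$ and $\alpha\in(0,2^{-20}N^{-10k}|\mathcal V|^{-2}]$. If $\mu_{\mathsf e}$ is two-wise independent for every $\mathsf e\in\mathcal E$, then there exists a constant $\gamma=\gamma(G,\alpha,K)>0$ such that $\mathsf{CC}(G,n,\alpha,K)\ge\gamma n$ for all sufficiently large $n$ (with $\alpha n$ an integer).
   Context: $\mathbb Z_N=\mathbb Z/N\mathbb Z$. A $k$-universe is a tuple $\mathcal U=(U_1,\dots,U_k)$ of finite sets of common cardinality $|\mathcal U|$; $\bigcup\mathcal U=\bigcup_iU_i$, $\prod\mathcal U=U_1\times\dots\times U_k$. For $0\le m\le|\mathcal U|$, $\mathcal M_{\mathcal U,m}$ is the set of $m$-element sets of pairwise vertex-disjoint tuples in $\prod\mathcal U$, and $\Omega^{\mathcal U,m}$ is the set of maps $\mathbf y:\prod\mathcal U\to\mathbb Z_N^k\cup\{\mathtt{nil}\}$ with $\mathrm{supp}(\mathbf y)=\{e:\mathbf y(e)\neq\mathtt{nil}\}\in\mathcal M_{\mathcal U,m}$. For $e=(v_1,\dots,v_k)$, $x_{|e}=(x_{v_1},\dots,x_{v_k})$. A distribution on $\mathbb Z_N^k$ is one-wise independent if each coordinate marginal is uniform, and two-wise independent if the marginal on any two distinct coordinates is uniform on $\mathbb Z_N^2$. $\mathbf P^{\mathcal U,m}_\mu(x,\cdot)$ ($x\in\mathbb Z_N^{\bigcup\mathcal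 U}$) is the distribution of $\mathbf y\in\Omega^{\mathcal U,m}$ obtained by sampling $M$ uniformly from $\mathcal M_{\mathcal U,m}$, setting $\mathbf y(e)=x_{|e}-w_e$ for $e\in M$ with independent $w_e\sim\mu$, and $\mathtt{nil}$ elsewhere. A distribution-labeled $k$-graph $G=(\mathcal V,\mathcal E,N,(\mu_{\mathsf e}))$: finite set $\mathcal V$, finite multiset $\mathcal E$ of ordered $k$-tuples of distinct elements of $\mathcal V$, integer $N\ge2$, one-wise independent $\mu_{\mathsf e}$ on $\mathbb Z_N^k$. $U_{\mathsf v}=\{\mathsf v\}\times[n]$, $\mathcal U_{\mathsf e}=(U_{\mathsf v_1},\dots,U_{\mathsf v_k})$ for $\mathsf e=(\mathsf v_1,\dots,\mathsf v_k)$; $\mathrm{proj}_{\mathsf e}$ is restriction to $\bigcup\mathcal U_{\mathsf e}$. In $\mathsf{DIHP}(G,n,\alpha,K)$, players $(\mathsf e,j)\in\mathcal E\times[K]$ receive $\mathbf y^{(\mathsf e,j)}\in\Omega^{\mathcal U_{\mathsf e},\alpha n}$; under $\mathcal D_{\mathrm{no}}$ inputs are independent uniform; under $\mathcal D_{\mathrm{yes}}$, $x$ is uniform in $\mathbb Z_N^{\mathcal V\times[n]}$ and independently $\mathbf y^{(\mathsf e,j)}\sim\mathbf P^{\mathcal U_{\mathsf e},\alpha n}_{\mu_{\mathsf e}}(\mathrm{proj}_{\mathsf e}(x),\cdot)$. A deterministic protocol $\Pi$ has players broadcast messages in turn (one per round, depending on own input and transcript), output $\Pi(\mathbf Y)\in\{0,1\}$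 determined by the transcript, cost $|\Pi|$ = total bits broadcast, $\mathrm{adv}(\Pi)=|\Pr_{\mathcal D_{\mathrm{yes}}}[\Pi=1]-\Pr_{\mathcal D_{\mathrm{no}}}[\Pi=1]|$. $\mathsf{CC}(G,n,\alpha,K)$ is the minimum cost of a protocol with $\mathrm{adv}\ge0.1$. *)

(* Defs.v *)
From HB Require Import structures.
From mathcomp Require Import all_boot all_order all_algebra.
From mathcomp Require Import reals.
Set Implicit Arguments. Unset Strict Implicit. Unset Printing Implicit Defensive.
Import Order.TTheory GRing.Theory Num.Theory.
Local Open Scope ring_scope.

Section DIHP.
Variable R : realType.

Definition Zk (N k : nat) := {ffun 'I_k -> 'Z_N}.

Definition is_distr N k (mu : {ffun Zk N k -> R}) :=
  (forall z, 0 <= mu z) /\ \sum_z mu z = 1.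

Definition onewise N k (mu : {ffun Zk N k -> R}) :=
  forall (i : 'I_k) (a : 'Z_N),
    \sum_(z : Zk N k | z i == a) mu z = (N%:R)^-1.

Definition twowise N k (mu : {ffun Zk N k -> R}) :=
  forall (i j : 'I_k) (a b : 'Z_N), i != j ->
    \sum_(z : Zk N k | (z i == a) && (z j == b)) mu z = (N%:R ^+ 2)^-1.

(* A distribution-labeled k-graph: vertex finType V, edge multiset indexed by
   the finType E via [edge : E -> {ffun 'I_k -> V}] (each edge a k-tuple of
   distinct vertices), integer N >= 2, and one-wise independent labels mu. *)
Definition dlgraph k (V E : finType) (edge : E -> {ffun 'I_k -> V}) N
  (mu : E -> {ffun Zk N k -> R}) :=
  [/\ forall e, injective (edge e), (1 < N)%N,
      forall e, is_distr (mu e) & forall e, onewise (mu e)].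

(* For an edge e = (v_1..v_k), the universe U_e = ({v_1}x[n],...,{v_k}x[n]);
   an element of prod U_e is represented by t : 'I_k -> 'I_n, standing for
   ((v_1, t 1), ..., (v_k, t k)). *)
Definition tup k n := {ffun 'I_k -> 'I_n}.

Definition vset k (V : finType) (ed : {ffun 'I_k -> V}) n (t : tup k n)
  : {set V * 'I_n} := [set (ed i, t i) | i : 'I_k].

Definition Mset k (V : finType) (ed : {ffun 'I_k -> V}) n m
  : {set {set tup k n}} :=
  [set S : {set tup k n} | (#|S| == m) &&
     [forall t in S, forall t' in S,
        (t != t') ==> [disjoint vset ed t & vset ed t']]].

Definition Ytype k n N := {ffun tup k n -> option (Zk N k)}.

Definition supp k n N (y : Ytype k n N) : {set tup k n} :=
  [set t | y t != None].

Definition Omega k (V : finType) (ed : {ffun 'I_k -> V}) n N m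
  : {set Ytype k n N} := [set y | supp y \in Mset ed n m].

Definition Xtype (V : finType) n N := {ffun V * 'I_n -> 'Z_N}.

Definition restr k (V : finType) (ed : {ffun 'I_k -> V}) n N
  (x : Xtype V n N) (t : tup k n) : Zk N k := [ffun i => x (ed i, t i)].

Definition zsub N k (a b : Zk N k) : Zk N k := [ffun i => a i - b i].

(* P^{U_e,m}_mu(x, y): M uniform in M_{U,m}, y(t) = x_|t - w_t, w_t ~ mu iid *)
Definition Pker k (V : finType) (ed : {ffun 'I_k -> V}) n N m
  (mu : {ffun Zk N k -> R}) (x : Xtype V n N) (y : Ytype k n N) : R :=
  if supp y \in Mset ed n m then
    (#|Mset ed n m|%:R)^-1 *
    \prod_(t in supp y) mu (zsub (restr ed x t) (odflt 0 (y t)))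
  else 0.

Definition Inputs k (E : finType) K n N := {ffun E * 'I_K -> Ytype k n N}.

Definition validY k (V E : finType) (edge : E -> {ffun 'I_k -> V}) K n N m
  (Y : Inputs k E K n N) :=
  [forall p : E * 'I_K, Y p \in Omega (edge p.1) n N m].

Definition Pno k (V E : finType) (edge : E -> {ffun 'I_k -> V}) K n N m
  (Y : Inputs k E K n N) : R :=
  \prod_(p : E * 'I_K)
     (if Y p \in Omega (edge p.1) n N m
      then (#|Omega (edge p.1) n N m|%:R)^-1 else 0).

Definition Pyes k (V E : finType) (edge : E -> {ffun 'I_k -> V}) N
  (mu : E -> {ffun Zk N k -> R}) K n m (Y : Inputs k E K n N) : R :=
  (#|{: Xtype V n N}|%:R)^-1 *
  \sum_(x : Xtype V n N)
     \prod_(p : E * 'I_K) Pker (edge p.1) m (mu p.1) x (Y p).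

(* Deterministic broadcast protocols.  The speaking order is a fixed
   sequence of players [sched] (one speaker per round); the length of the
   message of a round is determined by the transcript so far (so messages form
   a prefix-free code), its content by the speaker's own input and the
   transcript; the output is a function of the final transcript. *)
Record protocol (k : nat) (E : finType) (K n N : nat) := Protocol {
  sched : seq (E * 'I_K);
  mlen : seq bitseq -> nat;
  msg : E * 'I_K -> Ytype k n N -> seq bitseq -> bitseq;
  pout : seq bitseq -> bool }.

Definition wf_protocol k E K n N (P : protocol k E K n N) :=
  forall p y t, size (msg P p y t) = mlen P t.

Definition transcript k E K n N (P : protocol k E K n N)
  (Y : Inputs k E K n N) : seq bitseq :=
  foldl (fun t p => rcons t (msg P p (Y p) t)) [::] (sched P).

Definition run k E K n N (P : protocol k E K n N) (Y : Inputs k E K n N)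
  : bool := pout P (transcript P Y).

Definition cost k (V E : finType) (edge : E -> {ffun 'I_k -> V}) K n N m
  (P : protocol k E K n N) : nat :=
  \max_(Y : Inputs k E K n N | validY edge m Y)
     sumn (map size (transcript P Y)).

Definition adv k (V E : finType) (edge : E -> {ffun 'I_k -> V}) N
  (mu : E -> {ffun Zk N k -> R}) K n m (P : protocol k E K n N) : R :=
  `| \sum_(Y : Inputs k E K n N | run P Y) Pyes edge mu m Y
     - \sum_(Y : Inputs k E K n N | run P Y) Pno edge m Y |.

End DIHP.

(* Main.v *)
(* Write N^k mu = 1 + phi; two-wise independence says that phi averages to zero
   as soon as at most two coordinates are kept.  On a matching M the likelihood
   ratio of a player is the product over t in M of 1 + phi(x_t - y_t), i.e. the
   sum over T in M of the products over T, and it is cut at |T| <= s_p into a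
   low part and a tail.

   Low parts: the x-average of a product of terms T_p vanishes unless every tuple
   shares at least three vertices with other tuples.  Such a configuration of j
   tuples has at most (k - 3/2) j vertices, so the expected number of those
   contained in the random matchings is (C j / n)^(j/2), which is summable and
   small for j up to a small multiple of n.  This bound is uniform over Y, so it
   can be summed over all leaves of the protocol at once.

   Tails: conditionally on any set of inputs of one player, the second moment in
   x of the level-a part is a sum over two independent copies (T, T') in which
   every tuple of T shares three coordinates with T', hence at most 2^(-20 a).

   On a leaf (a rectangle), players are switched one by one from the full ratio,
   which has expectation at most 1, to the low part, which is crudely bounded by
   sum_{a <= s_p} C(m, a) 2^a.  Choosing s_1 >> s_2 >> ... >> cost, the tail of a
   player beats both the crude bounds of the later players and the number of
   leaves, at most 2^cost. *)
Require Import Defs.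
From HB Require Import structures.
From mathcomp Require Import all_boot all_order all_algebra.
From mathcomp Require Import reals.
From mathcomp Require Import ring lra zify.
Import Order.TTheory GRing.Theory Num.Theory.
Local Open Scope ring_scope.
Set Implicit Arguments. Unset Strict Implicit. Unset Printing Implicit Defensive.

(** * The likelihood ratio of one player, expanded over subsets of its matching *)

Section SinglePlayer.
Variables (R : realType) (k n N m : nat) (V : finType) (ed : {ffun 'I_k -> V}).
Hypothesis N_gt1 : (1 < N)%N.
Implicit Types (M T : {set tup k n}) (y : Ytype k n N) (x : Xtype V n N)
  (mu : {ffun Zk N k -> R}).

Lemma card_Zk : #|{: Zk N k}| = (N ^ k)%N.
Proof. by rewrite card_ffun !card_ord Zp_cast. Qed.

Lemma Nk_gt0 : 0 < (N ^ k)%:R :> R.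
Proof. by rewrite ltr0n expn_gt0 (ltn_trans _ N_gt1). Qed.

(** On a fixed support every label ranges freely over the non-nil values, so this is distributivity
    with [None] as the forced value off [M]. The default of [odflt] is never reached. *)
Lemma sum_labelings M (g : tup k n -> Zk N k -> R) :
  \sum_(y : Ytype k n N | supp y == M) \prod_(t in M) g t (odflt 0 (y t))
  = \prod_(t in M) \sum_z g t z.
Proof.
under [RHS]eq_bigr => t _.
  have -> : \sum_z g t z =
      \sum_(o : option (Zk N k) | o != None) g t (odflt 0 o).
    rewrite (reindex_omap Some id); last by case.
    by apply: eq_bigl => z; rewrite /= eqxx.
  over.
rewrite (big_distr_big_dep None); apply: eq_bigl => y.
apply/eqP/pfamilyP => [<-|[/subsetP sM yM]].
  split; first by apply/subsetP => t; rewrite !inE.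
  by move=> t; rewrite inE.
apply/setP => t; rewrite inE; apply/idP/idP => [yt|/yM //].
exact: (sM t yt).
Qed.

Lemma card_Omega : #|Omega ed n N m| = (#|Mset ed n m| * N ^ (k * m))%N.
Proof.
rewrite -sum1_card (partition_big (@supp k n N) (mem (Mset ed n m))) /=; last first.
  by move=> y; rewrite inE.
rewrite -sum_nat_const; apply: eq_bigr => M MM.
rewrite (eq_bigl (fun y => supp y == M)); last first.
  by move=> y; rewrite inE; case: eqP => [->|]; rewrite ?andbF ?MM.
apply/eqP; rewrite -(eqr_nat R) natr_sum; apply/eqP.
transitivity (\prod_(t in M) \sum_(z : Zk N k) (1 : R)).
  by rewrite -(sum_labelings M (fun _ _ => 1)); apply: eq_bigr => y _; rewrite big1.
rewrite prodr_const sumr_const card_Zk expnM natrX.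
by move: MM; rewrite inE => /andP[/eqP->].
Qed.

Definition pno y : R :=
  if y \in Omega ed n N m then (#|Omega ed n N m|%:R)^-1 else 0.

Lemma pno_ge0 y : 0 <= pno y.
Proof. by rewrite /pno; case: ifP; rewrite // invr_ge0. Qed.

Definition phi (mu : {ffun Zk N k -> R}) (z : Zk N k) : R :=
  (N ^ k)%:R * mu z - 1.

(** The argument of [ph] is the noise implied by [x] and the label. The default 0 concerns nil
    labels only, and the expansions give weight zero to any [T] outside the support. *)
Definition mono (ph : Zk N k -> R) T x y : R :=
  \prod_(t in T) ph (zsub (restr ed x t) (odflt 0 (y t))).

Lemma supp_card y : y \in Omega ed n N m -> #|supp y| = m :> nat.
Proof. by rewrite !inE => /andP[/eqP]. Qed.

(** By [card_Omega] the uniform density is that of the matching times N^(-k) for each tuple.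
    Dividing by it leaves a product of factors 1 + phi over the support, which is then multiplied
    out. *)
Lemma PkerE mu x y :
  Pker ed m mu x y = pno y * \sum_(T : {set tup k n} | T \subset supp y)
    mono (phi mu) T x y.
Proof.
have := @supp_card y; rewrite /Pker /pno inE.
case: ifP => [yM /(_ isT) cy|_ _]; last by rewrite mul0r.
pose F t := phi mu (zsub (restr ed x t) (odflt 0 (y t))).
transitivity ((#|Omega ed n N m|%:R)^-1 * \prod_(t in supp y) (F t + 1)).
  rewrite card_Omega natrM invfM -mulrA; congr (_ * _).
  under [in RHS]eq_bigr do rewrite /F /phi subrK.
  rewrite big_split /= prodr_const cy -natrX -expnM mulrA mulVf ?mul1r //.
  by rewrite pnatr_eq0 -lt0n expn_gt0 (ltn_trans _ N_gt1).
congr (_ * _).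
rewrite big_mkcond /=.
transitivity (\prod_t ((if t \in supp y then F t else 0) + 1)).
  by apply: eq_bigr => t _; case: ifP; rewrite ?add0r.
rewrite (bigA_distr 1 +%R) /= [RHS]big_mkcond /=.
apply: eq_big => // T _; case: ifP => [/subsetP sT|/negbT].
  rewrite [RHS]big_mkcond; apply: eq_bigr => t _.
  by case: ifP => // /sT ->.
case/subsetPn => t tT tn.
by rewrite (bigD1 t) //= tT (negbTE tn) mul0r.
Qed.

Lemma Pker_ge0 mu x y : is_distr mu -> 0 <= Pker ed m mu x y.
Proof.
case=> mu0 _; rewrite /Pker; case: ifP => // _.
by rewrite mulr_ge0 ?invr_ge0 // prodr_ge0.
Qed.

Lemma zsub_inj (c : Zk N k) : injective (zsub c).
Proof.
move=> a b /ffunP E; apply/ffunP => i; move: (E i); rewrite !ffunE.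
by move/addrI/oppr_inj.
Qed.

(** The total is 1 as soon as a matching of size [m] exists, and 0 otherwise; an inequality covers
    both cases. *)
Lemma Pker_sum_le1 mu x : is_distr mu -> \sum_y Pker ed m mu x y <= 1.
Proof.
case=> mu0 mu1; rewrite /Pker -big_mkcond /=.
rewrite (partition_big (@supp k n N) (mem (Mset ed n m))) //=.
have [->|/set0Pn [M0 M0M]] := eqVneq (Mset ed n m) set0.
  by rewrite big1 // => i; rewrite inE.
rewrite (eq_bigr (fun=> (#|Mset ed n m|%:R)^-1)).
  rewrite sumr_const -[_ *+ _]mulr_natr mulVf // pnatr_eq0 cards_eq0.
  by apply/set0Pn; exists M0.
move=> M MM; rewrite (eq_bigl (fun y => supp y == M)); last first.
  by move=> y; case: eqP => [->|]; rewrite ?andbF ?MM.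
rewrite -big_distrr /= -[RHS]mulr1; congr (_ * _).
transitivity (\prod_(t in M) \sum_z mu (zsub (restr ed x t) z)).
  rewrite -(sum_labelings M (fun t z => mu (zsub (restr ed x t) z))).
  by apply: eq_bigr => y /eqP ->.
rewrite big1 // => t _.
by rewrite -mu1 [RHS](reindex_inj (@zsub_inj (restr ed x t))).
Qed.

Lemma sum_abs_phi mu c : is_distr mu ->
  \sum_z `|phi mu (zsub c z)| <= (N ^ k)%:R * 2.
Proof.
case=> mu0 mu1; rewrite -(reindex_inj (@zsub_inj c) (P := predT) (F := fun z => `|phi mu z|)) /=.
apply: (@le_trans _ _ (\sum_z ((N ^ k)%:R * mu z + 1))).
  apply: ler_sum => z _; rewrite /phi (le_trans (ler_normB _ _)) //.
  by rewrite normr1 ger0_norm // mulr_ge0.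
rewrite big_split /= -big_distrr /= mu1 sumr_const card_Zk; lra.
Qed.

(** The probability that a uniform matching contains [T], read as 0 when there is no matching. *)
Definition prT T : R :=
  #|[set M in Mset ed n m | T \subset M]|%:R / #|Mset ed n m|%:R.

Lemma prT_ge0 T : 0 <= prT T.
Proof. by rewrite divr_ge0. Qed.

(** Given a matching containing [T], the labels are independent and uniform. A tuple of [T] then
    contributes the mean of |phi|, at most 2 by [sum_abs_phi], and any other tuple contributes 1. *)
Lemma sum_abs_mono mu T x : is_distr mu ->
  \sum_y pno y * ((T \subset supp y)%:R * `|mono (phi mu) T x y|)
    <= prT T * 2 ^+ #|T|.
Proof.
move=> dmu.
rewrite (bigID (mem (Omega ed n N m))) /= [X in _ + X]big1 ?addr0; last first.
  by move=> y /negbTE yM; rewrite /pno yM mul0r.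
rewrite (partition_big (@supp k n N) (mem (Mset ed n m))) /=; last first.
  by move=> y; rewrite inE.
have C0 : 0 <= (#|Omega ed n N m|%:R)^-1 :> R by rewrite invr_ge0.
apply: (@le_trans _ _ (\sum_(M in Mset ed n m | T \subset M)
   (#|Omega ed n N m|%:R)^-1 * ((N ^ (k * m))%:R * 2 ^+ #|T|))).
  rewrite [X in _ <= X]big_mkcondr; apply: ler_sum => M MM; case: ifP => [TM|TM]; last first.
    by rewrite big1 // => y /andP[_ /eqP ->]; rewrite TM mul0r mulr0.
  pose g t z : R := if t \in T then `|phi mu (zsub (restr ed x t) z)| else 1.
  rewrite (eq_big (fun y => supp y == M) (fun y => (#|Omega ed n N m|%:R)^-1 *
     \prod_(t in M) g t (odflt 0 (y t)))).
  - rewrite -big_distrr /= sum_labelings ler_wpM2l //.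
    apply: (@le_trans _ _ (\prod_(t in M) ((N ^ k)%:R * (if t \in T then 2 else 1)))).
      apply: ler_prod => t tM; rewrite sumr_ge0 /=; last first.
        by move=> z _; rewrite /g; case: ifP.
      rewrite /g; case: ifP => _; first exact: sum_abs_phi.
      by rewrite sumr_const card_Zk mulr1.
    rewrite big_split /= prodr_const.
    have -> : #|M| = m by move: MM; rewrite inE => /andP[/eqP].
    rewrite -[_%:R ^+ m]natrX -expnM ler_wpM2l // -big_mkcondr /=.
    rewrite (eq_bigl (mem T)) ?prodr_const // => t /=.
    by apply/andP/idP => [[]//|tT]; rewrite (subsetP TM).
  - by move=> y; rewrite inE; case: eqP => [->|]; rewrite ?andbF ?MM.
  - move=> y /andP[yM /eqP sy]; rewrite /pno yM sy TM mul1r; congr (_ * _).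
    rewrite /mono normr_prod /g -big_mkcondr /=.
    apply: eq_bigl => t /=.
    by apply/idP/andP => [tT|[]//]; rewrite (subsetP TM).
rewrite sumr_const -[leLHS]mulr_natl card_Omega natrM invfM /prT.
have -> : #|[pred M in Mset ed n m | T \subset M]| =
    #|[set M in Mset ed n m | T \subset M]|.
  by apply: eq_card => M; rewrite !inE.
rewrite -!mulrA mulKf //.
by rewrite pnatr_eq0 -lt0n expn_gt0 (ltn_trans _ N_gt1).
Qed.

(** Double counting: every matching has C(m, b) subsets of size [b]. *)
Lemma sum_prT b : \sum_(T : {set tup k n} | #|T| == b) prT T <= 'C(m, b)%:R.
Proof.
rewrite /prT -big_distrl /=.
have [->|/set0Pn [M0 M0M]] := eqVneq (Mset ed n m) set0.
  by rewrite cards0 invr0 mulr0.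
have Mpos : 0 < #|Mset ed n m|%:R :> R by rewrite ltr0n; apply/card_gt0P; exists M0.
rewrite ler_pdivrMr // -natr_sum -natrM ler_nat.
under eq_bigr => T _ do rewrite -sum1dep_card.
rewrite (exchange_big_dep (mem (Mset ed n m))) /=; last by move=> T M _ /andP[].
rewrite mulnC -sum_nat_const; apply: leq_sum => M MM.
rewrite sum1dep_card -(_ : #|M| = m); last by move: MM; rewrite inE => /andP[/eqP].
by rewrite -cards_draws; apply: subset_leq_card; apply/subsetP => T; rewrite !inE => /and3P[-> _ ->].
Qed.

End SinglePlayer.

(** * The probability that a random matching contains a given set of tuples *)

Lemma card_sigma (I J : finType) (P : pred I) (Q : I -> pred J) :
  #|[set u : I * J | P u.1 && Q u.1 u.2]| = (\sum_(i | P i) #|[set j | Q i j]|)%N.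
Proof.
rewrite -sum1dep_card -(pair_big_dep _ _ (fun _ _ => 1%N)) /=.
by apply: eq_bigr => i _; rewrite sum1dep_card.
Qed.

Section Switching.
Variables (R : realType) (k n m : nat) (V : finType) (ed : {ffun 'I_k -> V}).
Hypothesis ed_inj : injective ed.
Implicit Types (M T : {set tup k n}) (t u : tup k n).

Lemma mem_vset t i j : ((ed i, j) \in vset ed t) = (t i == j).
Proof.
apply/imsetP/eqP => [[i' _ [/ed_inj -> ->]] //|<-].
by exists i.
Qed.

Lemma disjoint_vset t u : [disjoint vset ed t & vset ed u] = [forall i, t i != u i].
Proof.
apply/pred0P/forallP => [D i|D v]; last first.
  apply/negbTE/negP => /= /andP[/imsetP[i _ ->]].
  by rewrite mem_vset eq_sym (negbTE (D i)).
by have /= := D (ed i, t i); rewrite !mem_vset eqxx /= eq_sym => ->.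
Qed.

Lemma MsetP M : reflect (#|M| = m :> nat /\
    {in M &, forall t u, t != u -> forall i, t i != u i}) (M \in Mset ed n m).
Proof.
rewrite inE; apply: (iffP andP) => -[].
  move=> /eqP cM D; split=> // t u tM uM tu i.
  move/forall_inP: D => /(_ t tM) /forall_inP /(_ u uM).
  by rewrite tu disjoint_vset /= => /forallP.
move=> cM D; split; first exact/eqP.
apply/forall_inP => t tM; apply/forall_inP => u uM; apply/implyP => tu.
by rewrite disjoint_vset; apply/forallP => i; apply: D.
Qed.

Lemma card_avoid M :
  ((n - #|M|) ^ k <= #|[set u : tup k n | [forall t in M, [forall i, u i != t i]]]|)%N.
Proof.
pose F (i : 'I_k) : {set 'I_n} := ~: ((fun t : tup k n => t i) @: M).
have -> : #|[set u : tup k n | [forall t in M, [forall i, u i != t i]]]|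
    = (\prod_(i < k) #|F i|)%N.
  rewrite -sum1dep_card (eq_bigr (fun i => \sum_(j in F i) 1)%N); last first.
    by move=> i _; rewrite sum1_card.
  rewrite bigA_distr_big_dep [RHS](eq_bigr (fun=> 1%N)); last by move=> *; rewrite big1.
  apply: eq_bigl => u; apply/forall_inP/familyP => [H i|H t tM].
    rewrite inE; apply/negP => /imsetP[t tM E].
    by have /forallP/(_ i) := H t tM; rewrite E eqxx.
  apply/forallP => i; apply: contraTneq (H i) => ->; rewrite inE negbK.
  exact: imset_f.
have <- : (\prod_(i < k) (n - #|M|) = (n - #|M|) ^ k)%N by rewrite prod_nat_const card_ord.
apply: leq_prod => i _.
by rewrite (cardsCs (F i)) setCK card_ord leq_sub2l // leq_imset_card.
Qed.

(** In a matching containing t and [T], replace t by any tuple u that avoids the rest of the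
    matching; there are at least (n - (m - 1))^k choices. The result contains [T], and marking u
    among its m tuples makes the replacement injective. *)
Lemma switching T t : t \notin T ->
  (#|[set M in Mset ed n m | t |: T \subset M]| * (n - m.-1) ^ k
   <= m * #|[set M in Mset ed n m | T \subset M]|)%N.
Proof.
move=> tT.
pose Q M : pred (tup k n) := fun u => [forall w in M :\ t, [forall i, u i != w i]].
pose D := [set p : {set tup k n} * tup k n |
   ((p.1 \in Mset ed n m) && (t |: T \subset p.1)) && Q p.1 p.2].
pose D' := [set p : {set tup k n} * tup k n |
   ((p.1 \in Mset ed n m) && (T \subset p.1)) && (p.2 \in p.1)].
pose g (p : {set tup k n} * tup k n) := (p.2 |: p.1 :\ t, p.2).
have QN M u : Q M u -> u \notin M :\ t.
  move=> /forall_inP H; apply/negP => uM; have := uM; rewrite !inE => /andP[ut _].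
  case/negP: ut; apply/eqP/ffunP => i.
  by have /forallP/(_ i) := H u uM; rewrite eqxx.
have le1 : (#|[set M in Mset ed n m | t |: T \subset M]| * (n - m.-1) ^ k <= #|D|)%N.
  rewrite /D (card_sigma (fun M => (M \in Mset ed n m) && (t |: T \subset M)) Q).
  rewrite -sum_nat_cond_const; rewrite [X in (X <= _)%N](eq_bigl
    (fun M => (M \in Mset ed n m) && (t |: T \subset M))); last by move=> M; rewrite inE.
  apply: leq_sum => M /andP[/MsetP[cM _]]; rewrite subUset sub1set => /andP[tM _].
  have -> : m.-1 = #|M :\ t| by rewrite -cM (cardsD1 t M) tM.
  exact: card_avoid.
have E2 : #|D'| = (m * #|[set M in Mset ed n m | T \subset M]|)%N.
  rewrite /D' (card_sigma (fun M => (M \in Mset ed n m) && (T \subset M)) (fun M => mem M)).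
  rewrite mulnC -sum_nat_cond_const; apply: eq_big => M; first by rewrite !inE.
  move=> /andP[/MsetP[cM _] _]; rewrite -cM; apply: eq_card => u; by rewrite inE.
rewrite -E2; apply: (leq_trans le1).
have <- : #|g @: D| = #|D|.
  apply: card_in_imset => -[M u] [M' u']; rewrite !inE /=.
  move=> /andP[/andP[_ tM] qM] /andP[/andP[_ tM'] qM'] [E Eu]; subst u'.
  have {}E : M :\ t = M' :\ t.
    by rewrite -(setU1K (QN _ _ qM)) E (setU1K (QN _ _ qM')).
  congr (_, _).
  have tM1 : t \in M by apply: (subsetP tM); rewrite !inE eqxx.
  have tM2 : t \in M' by apply: (subsetP tM'); rewrite !inE eqxx.
  by rewrite -(setD1K tM1) E setD1K.
apply: subset_leq_card; apply/subsetP => p /imsetP[[M u]]; rewrite inE /=.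
move=> /andP[/andP[/MsetP[cM dM] tM] qM] ->; rewrite inE /= setU11 andbT.
move: (tM); rewrite subUset sub1set => /andP[tM1 TM].
apply/andP; split; last first.
  apply/subsetP => w wT; rewrite !inE; apply/orP; right.
  rewrite (subsetP TM) // andbT; apply: contraNneq tT => <- //.
apply/MsetP; split.
  by rewrite cardsU1 (QN _ _ qM) -cM (cardsD1 t M) tM1.
move: qM => /forall_inP qM.
move=> a b; rewrite !in_setU1 => /orP[/eqP ->|aM] /orP[/eqP ->|bM] ab i.
- by rewrite eqxx in ab.
- by have /forallP := qM b bM.
- by rewrite eq_sym; have /forallP := qM a aM.
- by apply: dM => //; [case/setD1P: aM|case/setD1P: bM].
Qed.

Lemma card_superset T :
  (#|[set M in Mset ed n m | T \subset M]| * (n - m.-1) ^ (k * #|T|)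
   <= m ^ #|T| * #|Mset ed n m|)%N.
Proof.
have [c] := ubnP #|T|; elim: c T => // c IH T /ltnSE leTc.
have [->|/set0Pn[t tT]] := eqVneq T set0.
  rewrite cards0 muln0 !expn0 muln1 mul1n; apply: subset_leq_card.
  by apply/subsetP => M; rewrite inE => /andP[].
have cT : #|T| = #|T :\ t|.+1 by rewrite (cardsD1 t T) tT.
have /IH {}IH : (#|T :\ t| < c)%N by rewrite -cT.
have := @switching (T :\ t) t; rewrite setD11 setD1K // => /(_ isT) H.
rewrite cT mulnS expnD mulnA expnS.
apply: (leq_trans (leq_mul H (leqnn _))).
by rewrite -!mulnA leq_mul2l IH orbT.
Qed.

(** The cost m / (n - m + 1)^k of one tuple in [card_superset], simplified through n - m + 1 >= n /
    2. *)
Definition beta : R := m%:R * 2 ^+ k / n%:R ^+ k.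

Lemma prT_le T : (m.*2 <= n)%N -> (0 < n)%N -> prT R m ed T <= beta ^+ #|T|.
Proof.
move=> mn n0; rewrite /prT /beta.
have [->|/set0Pn [M0 M0M]] := eqVneq (Mset ed n m) set0.
  by rewrite cards0 invr0 mulr0 exprn_ge0 // divr_ge0 // ?mulr_ge0 // exprn_ge0.
have Mpos : 0 < #|Mset ed n m|%:R :> R by rewrite ltr0n; apply/card_gt0P; exists M0.
have np : 0 < n%:R :> R by rewrite ltr0n.
rewrite ler_pdivrMr //.
have := card_superset T; rewrite -(ler_nat R) !natrM !natrX.
set A := #|[set _ in _ | _]|%:R; set B := #|Mset _ _ _|%:R => H.
have h : n%:R / 2 <= (n - m.-1)%:R :> R.
  by rewrite ler_pdivrMr // -natrM ler_nat; lia.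
have p2 : 0 < n%:R / 2 :> R by rewrite divr_gt0.
have h2 : (n%:R / 2) ^+ (k * #|T|) <= (n - m.-1)%:R ^+ (k * #|T|) :> R.
  by rewrite lerXn2r // nnegrE ltW // (lt_le_trans p2).
have {}H : A * (n%:R / 2) ^+ (k * #|T|) <= m%:R ^+ #|T| * B.
  by apply: le_trans H; rewrite ler_wpM2l.
rewrite -(ler_pM2r (exprn_gt0 (k * #|T|) p2)); apply: (le_trans H).
rewrite [leRHS]mulrAC ler_wpM2r ?(ltW Mpos) //.
suff -> : (m%:R * 2 ^+ k / n%:R ^+ k) ^+ #|T| * (n%:R / 2) ^+ (k * #|T|) = m%:R ^+ #|T| :> R by [].
rewrite exprM -exprMn; congr (_ ^+ _).
rewrite expr_div_n; field.
by rewrite !expf_neq0 ?pnatr_eq0 -?lt0n.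
Qed.

End Switching.

(** * Averages of phi with at most two coordinates fixed *)

Definition mix N k (B : {set 'I_k}) (c u : Zk N k) : Zk N k :=
  [ffun i => if i \in B then c i else u i].

(** The sum runs over all coordinates of u, including the overwritten ones in [B]. These only repeat
    each term N^|B| times, and the form fits a shift of x by a full vector u. *)
Definition vanishing (R : realType) N k (ph : Zk N k -> R) :=
  forall (B : {set 'I_k}) (c : Zk N k), (#|B| <= 2)%N ->
    \sum_(u : Zk N k) ph (mix B c u) = 0.

Lemma sum_mix (R : realType) N k (g : Zk N k -> R) B c : (1 < N)%N ->
  \sum_u g (mix B c u) =
  (N ^ #|B|)%:R * \sum_(z : Zk N k | [forall i in B, z i == c i]) g z.
Proof.
move=> N1.
rewrite (partition_big (mix B c) (fun z : Zk N k => [forall i in B, z i == c i])) /=; last first.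
  by move=> u _; apply/forall_inP => i iB; rewrite ffunE iB.
rewrite big_distrr /=; apply: eq_bigr => z /forall_inP zc.
rewrite (eq_bigr (fun=> g z)); last by move=> u /eqP ->.
rewrite big_const iter_addr addr0 -[LHS]mulr_natl; congr (_%:R * _).
pose F i : pred 'Z_N := if i \in B then predT else pred1 (z i).
transitivity (\prod_i \sum_(a in F i) 1)%N; last first.
  rewrite -prod_nat_const [RHS]big_mkcond; apply: eq_bigr => i _; rewrite sum1_card /F.
  by case: ifP => _; rewrite ?card1 // card_ord Zp_cast.
rewrite bigA_distr_big_dep (eq_bigr (fun=> 1%N)); last by move=> *; rewrite big1.
rewrite sum1_card; apply: eq_card => u; transitivity (mix B c u == z); [by []|apply/eqP/familyP] => [E i|H].
  rewrite /F -topredE /= -E !ffunE; by case: ifP => iB; rewrite // iB inE.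
apply/ffunP => i; have := H i; rewrite /F -topredE /= ffunE.
by case: ifP => [iB _|_ /eqP //]; apply/esym/eqP/zc.
Qed.

(** For |B| = 0, 1, 2 the marginal on [B] is given by total mass, one-wise and two-wise
    independence; in each case it equals N^(-|B|), which cancels the constant 1 in phi. *)
Lemma phi_vanishing (R : realType) N k (mu : {ffun Zk N k -> R}) : (1 < N)%N ->
  is_distr mu -> onewise mu -> twowise mu -> vanishing (phi mu).
Proof.
move=> N1 [_ mu1] o1 o2 B c cB.
rewrite /phi sumrB -big_distrr /= sumr_const card_Zk // sum_mix //.
suff -> : \sum_(z : Zk N k | [forall i in B, z i == c i]) mu z = (N ^ #|B|)%:R^-1.
  by rewrite mulfV ?mulr1 ?subrr // pnatr_eq0 expn_eq0; case: N N1 {mu mu1 o1 o2 c} => //.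
case E: #|B| cB => [|[|[|//]]] _.
- move/eqP: E; rewrite cards_eq0 => /eqP ->.
  rewrite expn0 invr1 -mu1; apply: eq_bigl => z; apply/forall_inP => i.
  by rewrite inE.
- move/eqP: E => /cards1P[i ->]; rewrite expn1 -(o1 i (c i)); apply: eq_bigl => z.
  apply/forall_inP/idP => [|H j]; first by apply; rewrite inE.
  by rewrite inE => /eqP ->.
- move/eqP: E => /cards2P[i [j [ij ->]]]; rewrite natrX -(o2 i j (c i) (c j) ij).
  apply: eq_bigl => z; apply/forall_inP/andP => [H|[Hi Hj] l].
    by split; apply: H; rewrite !inE eqxx ?orbT.
  by rewrite !inE => /orP[] /eqP ->.
Qed.

(** * Averages over x of products attached to a family of tuple sets *)

Section Families.
Variables (R : realType) (k n N : nat) (V J : finType) (ed : J -> {ffun 'I_k -> V}).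
Hypothesis N_gt1 : (1 < N)%N.
Hypothesis ed_inj : forall j, injective (ed j).
Implicit Types (f : {ffun J -> {set tup k n}}) (Y : J -> Ytype k n N).

(** The index type [J] stays abstract because it serves twice: for all players at once, and as
    [bool] for two copies of a single player. *)
Definition shared f (z : J * tup k n) : {set 'I_k} :=
  [set i | [exists z' : J * tup k n, [&& z'.2 \in f z'.1, z' != z &
     (ed z.1 i, z.2 i) \in vset (ed z'.1) z'.2]]].

Definition bad f := [forall z : J * tup k n, (z.2 \in f z.1) ==> (2 < #|shared f z|)%N].

Definition famono (ph : J -> Zk N k -> R) f (x : Xtype V n N) Y : R :=
  \prod_j mono (ed j) (ph j) (f j) x (Y j).

Lemma famonoE ph f x Y : famono ph f x Y =
  \prod_(z : J * tup k n | z.2 \in f z.1)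
    ph z.1 (zsub (restr (ed z.1) x z.2) (odflt 0 (Y z.1 z.2))).
Proof. by rewrite /famono pair_big_dep /=. Qed.

(* The coordinates of x private to a tuple can be resampled without changing the
   other factors; with at most two coordinates left, two-wise independence kills
   the average. *)
Lemma sum_famono_eq0 ph f Y : (forall j, vanishing (ph j)) -> ~~ bad f ->
  \sum_x famono ph f x Y = 0.
Proof.
move=> van; rewrite negb_forall => /existsP[z]; rewrite negb_imply -leqNgt => /andP[zf sz].
set B := shared f z in sz.
(* A shift of x carried by the unshared vertices of z alone; [pick] inverts the injective map from
   coordinates to vertices. *)
pose sh (u : Zk N k) (v : V * 'I_n) : 'Z_N :=
  if [pick i | (i \notin B) && ((ed z.1 i, z.2 i) == v)] is Some i then u i else 0.
have shE u i : sh u (ed z.1 i, z.2 i) = if i \in B then 0 else u i.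
  rewrite /sh; case: pickP => [j /andP[jB /eqP[/ed_inj E _]]|/(_ i)].
    by subst j; rewrite (negbTE jB).
  by rewrite eqxx andbT => /negbFE ->.
have sh0 u z' i : z'.2 \in f z'.1 -> z' != z -> sh u (ed z'.1 i, z'.2 i) = 0.
  move=> zf' zz'; rewrite /sh; case: pickP => // j /andP[jB /eqP E].
  case/negP: jB; rewrite inE; apply/existsP; exists z'; rewrite zf' zz' E /=.
  by apply/imsetP; exists i.
pose add u (x : Xtype V n N) : Xtype V n N := [ffun v => x v + sh u v].
have addI u : injective (add u).
  by move=> x y /ffunP E; apply/ffunP => v; have := E v; rewrite !ffunE => /addIr.
pose rest x := \prod_(z' | (z'.2 \in f z'.1) && (z' != z))
    ph z'.1 (zsub (restr (ed z'.1) x z'.2) (odflt 0 (Y z'.1 z'.2))).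
have step x u : famono ph f (add u x) Y = ph z.1 (zsub (restr (ed z.1) (add u x) z.2)
    (odflt 0 (Y z.1 z.2))) * rest x.
  rewrite famonoE (bigD1 z) //=; congr (_ * _); apply: eq_bigr => z' /andP[zf' zz'].
  by congr (ph _ (zsub _ _)); apply/ffunP => i; rewrite !ffunE sh0 ?addr0.
(* Each shift permutes the assignments x, so averaging over u changes nothing, while only the factor
   of z depends on u. *)
have avg : (N ^ k)%:R * \sum_x famono ph f x Y = \sum_x \sum_u famono ph f (add u x) Y.
  rewrite exchange_big /= -(card_Zk k N_gt1) mulr_natl -sumr_const.
  by apply: eq_bigr => u _; rewrite [LHS](reindex_inj (addI u)).
have Nk0 : (N ^ k)%:R != 0 :> R by rewrite gt_eqF ?Nk_gt0.
apply: (mulfI Nk0); rewrite avg mulr0; apply: big1 => x _.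
under eq_bigr => u _ do rewrite step.
rewrite -big_distrl /=; apply/eqP; rewrite mulf_eq0; apply/orP; left; apply/eqP.
pose c := zsub (restr (ed z.1) x z.2) (odflt 0 (Y z.1 z.2)).
pose sc (u : Zk N k) : Zk N k := [ffun i => c i + u i].
have sI : injective sc.
  by move=> a b /ffunP E; apply/ffunP => i; have := E i; rewrite !ffunE => /addrI.
rewrite -[RHS](van z.1 B c sz) [RHS](reindex_inj sI); apply: eq_bigr => u _; congr (ph _ _).
apply/ffunP => i; rewrite !ffunE shE; case: ifP => _; first by rewrite addr0.
by rewrite addrAC.
Qed.

Lemma norm_avg_famono ph f Y : (forall j, vanishing (ph j)) ->
  `|\sum_x famono ph f x Y| <= (bad f)%:R * \sum_x `|famono ph f x Y|.
Proof.
move=> van; case: (boolP (bad f)) => bf.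
  by rewrite mul1r ler_norm_sum.
by rewrite sum_famono_eq0 // normr0 mul0r.
Qed.

End Families.

(** * Averages over a finite set *)

Section Average.
Variables (R : realType) (X : finType).
Implicit Types g h : X -> R.

Definition avg g : R := (#|X|%:R)^-1 * \sum_x g x.

Lemma eq_avg g h : g =1 h -> avg g = avg h.
Proof. by move=> E; rewrite /avg; congr (_ * _); apply: eq_bigr. Qed.

Lemma avgD g h : avg (fun x => g x + h x) = avg g + avg h.
Proof. by rewrite /avg big_split mulrDr. Qed.

Lemma avgZ c g : avg (fun x => c * g x) = c * avg g.
Proof. by rewrite /avg -big_distrr /= mulrCA. Qed.

Lemma avgB g h : avg (fun x => g x - h x) = avg g - avg h.
Proof. by rewrite /avg sumrB mulrBr. Qed.

Lemma avg_sum (I : finType) (P : pred I) (F : I -> X -> R) :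
  avg (fun x => \sum_(i | P i) F i x) = \sum_(i | P i) avg (F i).
Proof. by rewrite /avg exchange_big big_distrr. Qed.

Lemma ler_avg g h : (forall x, g x <= h x) -> avg g <= avg h.
Proof. by move=> H; rewrite /avg ler_wpM2l ?invr_ge0 // ler_sum. Qed.

Lemma ler_norm_avg g : `|avg g| <= avg (fun x => `|g x|).
Proof.
by rewrite /avg normrM ger0_norm ?invr_ge0 // ler_wpM2l ?invr_ge0 // ler_norm_sum.
Qed.

Lemma avg_cst c : (0 < #|X|)%N -> avg (fun=> c) = c.
Proof.
move=> X0; rewrite /avg sumr_const -[c *+ _]mulr_natl mulKf // pnatr_eq0 -lt0n //.
Qed.

(** The variance of |g| is nonnegative. *)
Lemma avg_norm_sqr g : (0 < #|X|)%N ->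
  avg (fun x => `|g x|) ^+ 2 <= avg (fun x => g x ^+ 2).
Proof.
move=> X0; set c := avg (fun x => `|g x|).
have : 0 <= avg (fun x => (`|g x| - c) ^+ 2).
  by rewrite -(avg_cst 0 X0); apply: ler_avg => x; rewrite sqr_ge0.
rewrite (eq_avg (h := fun x => g x ^+ 2 - (2 * c * `|g x| - c ^+ 2))).
  by rewrite avgB avgB avgZ avg_cst // -/c; lra.
by move=> x; rewrite sqrrB real_normK ?num_real //; ring.
Qed.

End Average.

(** * Truncated likelihood ratios as sums over families, and their averages *)

Section FamilyBound.
Variables (R : realType) (k n N m : nat) (V J : finType).
Variables (ed : J -> {ffun 'I_k -> V}) (mu : J -> {ffun Zk N k -> R}).
Hypothesis N_gt1 : (1 < N)%N.
Hypothesis ed_inj : forall j, injective (ed j).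
Hypothesis mu_distr : forall j, is_distr (mu j).
Hypothesis mu_van : forall j, vanishing (phi (mu j)).
Implicit Types (f : {ffun J -> {set tup k n}}).
Local Notation X := (Xtype V n N).
Local Notation Yj := {ffun J -> Ytype k n N}.
Local Notation Fj := {ffun J -> {set tup k n}}.

Lemma card_X_gt0 : (0 < #|{: X}|)%N.
Proof. by apply/card_gt0P; exists [ffun=> 0]. Qed.

Definition fweight f : R := (bad ed f)%:R * \prod_j (prT R m (ed j) (f j) * 2 ^+ #|f j|).

(** For each Y the x-average vanishes unless [f] is bad. For bad [f] absolute values are moved
    inside, and at fixed x the sum over Y factors over the players, each bounded by
    [sum_abs_mono]. *)
Lemma family_bound f :
  \sum_(Y : Yj) (\prod_j (pno R m (ed j) (Y j) * (f j \subset supp (Y j))%:R)) *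
    `|avg (fun x : X => famono ed (fun j => phi (mu j)) f x Y)| <= fweight f.
Proof.
set ph := fun j => phi (mu j).
have coef_ge0 (Y : Yj) :
    0 <= \prod_j (pno R m (ed j) (Y j) * (f j \subset supp (Y j))%:R).
  by rewrite prodr_ge0 // => j _; rewrite mulr_ge0 ?pno_ge0.
apply: (@le_trans _ _ (\sum_(Y : Yj)
   (\prod_j (pno R m (ed j) (Y j) * (f j \subset supp (Y j))%:R)) *
   ((bad ed f)%:R * avg (fun x : X => `|famono ed ph f x Y|)))).
  apply: ler_sum => Y _; rewrite ler_wpM2l // /avg normrM ger0_norm ?invr_ge0 //.
  by rewrite mulrCA ler_wpM2l ?invr_ge0 // norm_avg_famono.
under eq_bigr => Y _ do rewrite mulrCA.
rewrite -big_distrr /= ler_wpM2l //.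
under eq_bigr => Y _ do rewrite -avgZ.
rewrite -(avg_sum predT) -[leRHS](avg_cst _ card_X_gt0); apply: ler_avg => x.
rewrite (eq_bigr (fun Y : Yj => \prod_j (pno R m (ed j) (Y j) *
    ((f j \subset supp (Y j))%:R * `|mono (ed j) (ph j) (f j) x (Y j)|)))); last first.
  move=> Y _; rewrite /famono normr_prod -big_split /=.
  by apply: eq_bigr => j _; rewrite mulrA.
rewrite -(bigA_distr_bigA (fun j y => pno R m (ed j) y *
    ((f j \subset supp y)%:R * `|mono (ed j) (ph j) (f j) x y|))) /=.
apply: ler_prod => j _; rewrite sum_abs_mono // andbT sumr_ge0 // => y _.
by rewrite !mulr_ge0 ?pno_ge0.
Qed.

Definition lpart (P : pred {set tup k n}) j (x : X) y : R :=
  \sum_(T : {set tup k n} | P T && (T \subset supp y)) mono (ed j) (phi (mu j)) T x y.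

Lemma prod_lpart (P : J -> pred {set tup k n}) (Y : Yj) (x : X) :
  \prod_j lpart (P j) j x (Y j) =
  \sum_(f : Fj | [forall j, P j (f j)])
     (\prod_j (f j \subset supp (Y j))%:R) * famono ed (fun j => phi (mu j)) f x Y.
Proof.
rewrite /lpart.
transitivity (\prod_j \sum_(T : {set tup k n}) (P j T)%:R * ((T \subset supp (Y j))%:R *
     mono (ed j) (phi (mu j)) T x (Y j))).
  apply: eq_bigr => j _; rewrite big_mkcond; apply: eq_bigr => T _.
  by case: (P j T); case: (_ \subset _); rewrite ?mul1r ?mul0r.
rewrite bigA_distr_bigA /= [RHS]big_mkcond; apply: eq_bigr => f _.
rewrite big_split /= big_split /= -/(famono _ _ _ _ _).
case: ifP => [/forallP H|/negbT]; first by rewrite big1 ?mul1r // => j _; rewrite H.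
by rewrite negb_forall => /existsP[j /negbTE Pj]; rewrite (bigD1 j) //= Pj !mul0r.
Qed.

(** The family of empty sets contributes exactly 1, which cancels; every other admissible family is
    bounded by [family_bound]. *)
Lemma low_part_near1 (P : J -> pred {set tup k n}) :
  (forall j, P j set0) ->
  \sum_(Y : Yj) (\prod_j pno R m (ed j) (Y j)) *
     `|avg (fun x : X => \prod_j lpart (P j) j x (Y j)) - 1|
  <= \sum_(f : Fj | [forall j, P j (f j)] && (f != [ffun=> set0])) fweight f.
Proof.
move=> P0; pose f0 : {ffun J -> {set tup k n}} := [ffun=> set0].
have Pf0 : [forall j, P j (f0 j)] by apply/forallP => j; rewrite ffunE.
have c0 (Y : Yj) : 0 <= \prod_j pno R m (ed j) (Y j).
  by rewrite prodr_ge0 // => j _; rewrite pno_ge0.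
apply: (@le_trans _ _ (\sum_(Y : Yj)
   \sum_(f : Fj | [forall j, P j (f j)] && (f != f0))
   (\prod_j (pno R m (ed j) (Y j) * (f j \subset supp (Y j))%:R)) *
    `|avg (fun x : X => famono ed (fun j => phi (mu j)) f x Y)|)); last first.
  by rewrite exchange_big /=; apply: ler_sum => f _; apply: family_bound.
apply: ler_sum => Y _.
have E1 : avg (fun x : X => (\prod_j (f0 j \subset supp (Y j))%:R) *
    famono ed (fun j => phi (mu j)) f0 x Y) = 1.
  rewrite avgZ big1 ?mul1r => [|j _]; last by rewrite ffunE sub0set.
  rewrite -[RHS](avg_cst 1 card_X_gt0); apply: eq_avg => x.
  by rewrite /famono big1 // => j _; rewrite ffunE /mono big_set0.
rewrite (eq_avg (fun x => prod_lpart P Y x)) avg_sum (bigD1 f0 Pf0) /= E1.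
rewrite addrAC subrr add0r.
apply: (@le_trans _ _ ((\prod_j pno R m (ed j) (Y j)) *
  \sum_(f : Fj | [forall j, P j (f j)] && (f != f0)) `|avg (fun x : X =>
     (\prod_j (f j \subset supp (Y j))%:R) * famono ed (fun j => phi (mu j)) f x Y)|)).
  by rewrite ler_wpM2l // ler_norm_sum.
rewrite big_distrr /=; apply: ler_sum => f _.
rewrite avgZ normrM big_split /= -mulrA ler_wpM2l // ger0_norm //.
by rewrite prodr_ge0.
Qed.

(** With [w] the indicator of one side of a rectangle and [P] always true, this is the probability
    given x that the player's input lies in that side. Other [P] keep only part of the likelihood
    ratio. *)
Definition vpart (w : Ytype k n N -> R) (P : pred {set tup k n}) j (x : X) : R :=
  \sum_y pno R m (ed j) y * w y * lpart P j x y.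

Lemma prod_vpart (w : J -> Ytype k n N -> R) (P : J -> pred {set tup k n}) (x : X) :
  \prod_j vpart (w j) (P j) j x =
  \sum_(Y : Yj) (\prod_j (pno R m (ed j) (Y j) * w j (Y j))) * \prod_j lpart (P j) j x (Y j).
Proof.
by rewrite bigA_distr_bigA; apply: eq_bigr => Y _; rewrite big_split.
Qed.

Lemma avg_prod_vpart (w : J -> Ytype k n N -> R) (P : J -> pred {set tup k n}) :
  (forall j y, 0 <= w j y <= 1) ->
  `|avg (fun x : X => \prod_j vpart (w j) (P j) j x)|
  <= \sum_(f : Fj | [forall j, P j (f j)]) fweight f.
Proof.
move=> w01; rewrite (eq_avg (prod_vpart w P)) avg_sum.
apply: (@le_trans _ _ (\sum_(f : Fj | [forall j, P j (f j)]) \sum_(Y : Yj)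
   (\prod_j (pno R m (ed j) (Y j) * (f j \subset supp (Y j))%:R)) *
    `|avg (fun x : X => famono ed (fun j => phi (mu j)) f x Y)|)); last first.
  by apply: ler_sum => f _; apply: family_bound.
rewrite exchange_big /=; apply: (le_trans (ler_norm_sum _ _ _)); apply: ler_sum => Y _.
rewrite avgZ (eq_avg (fun x => prod_lpart P Y x)) avg_sum normrM.
apply: (@le_trans _ _ ((\prod_j pno R m (ed j) (Y j)) *
  \sum_(f : Fj | [forall j, P j (f j)]) `|avg (fun x : X =>
     (\prod_j (f j \subset supp (Y j))%:R) * famono ed (fun j => phi (mu j)) f x Y)|)).
  rewrite ler_pM // ?ler_norm_sum // normr_prod; apply: ler_prod => j _.
  have /andP[w0 w1] := w01 j (Y j).
  by rewrite normr_ge0 ger0_norm ?mulr_ge0 ?pno_ge0 //= ler_piMr ?pno_ge0.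
rewrite big_distrr /=; apply: ler_sum => f _.
rewrite avgZ normrM big_split /= -mulrA ler_wpM2l //.
  by rewrite prodr_ge0 // => j _; rewrite pno_ge0.
by rewrite ger0_norm // prodr_ge0.
Qed.

End FamilyBound.

(** * Binomial estimates, and the second moment of one level through two copies *)

(** A weak Stirling bound: a^a is at most the falling factorial of 2a of length a, which is C(2a, a)
    a!, and C(2a, a) <= 4^a. *)
Lemma expn_self_le_fact a : (a ^ a <= 4 ^ a * a`!)%N.
Proof.
have h1 : (a ^ a <= (a + a) ^_ a)%N.
  rewrite ffact_prod -[X in (_ ^ X <= _)%N](card_ord a) -prod_nat_const.
  by apply: leq_prod => i _; rewrite -addnBA ?leq_addr // ltnW.
apply: (leq_trans h1); rewrite -bin_ffact leq_mul2r; apply/orP; right.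
rewrite (_ : 4 ^ a = 2 ^ (a + a))%N; last by rewrite addnn -mul2n expnM.
rewrite -(card_ord (a + a)) -card_draws; apply: (leq_trans (max_card _)).
by rewrite -[X in (X <= _)%N]cardsT -powersetT card_powerset cardsT.
Qed.

Lemma bin_fact_le x a : ('C(x, a) * a`! <= x ^ a)%N.
Proof.
rewrite bin_ffact ffact_prod -[X in (_ <= _ ^ X)%N](card_ord a) -prod_nat_const.
by apply: leq_prod => i _; rewrite leq_subr.
Qed.

Lemma bin_le_pow (R : realType) x a (y : R) : (0 < a)%N -> x%:R <= y ->
  'C(x, a)%:R <= (4 * y / a%:R) ^+ a.
Proof.
move=> a0 xy; have y0 : 0 <= y by apply: le_trans xy.
have aa0 : 0 < (a ^ a)%:R :> R by rewrite ltr0n expn_gt0 a0.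
rewrite expr_div_n -natrX ler_pdivlMr // exprMn.
have := expn_self_le_fact a; rewrite -(ler_nat R) natrM => h.
apply: (le_trans (ler_wpM2l _ h)) => //.
rewrite mulrCA natrX ler_wpM2l ?exprn_ge0 // -natrM.
apply: (@le_trans _ _ (x ^ a)%:R); first by rewrite ler_nat bin_fact_le.
by rewrite natrX lerXn2r ?nnegrE.
Qed.

Section TwoCopies.
Variables (R : realType) (k n N m : nat) (V : finType) (ed : {ffun 'I_k -> V}).
Hypothesis N_gt1 : (1 < N)%N.
Hypothesis ed_inj : injective ed.
Implicit Types (T : {set tup k n}).

Definition covered T : {set tup k n} :=
  [set t : tup k n | (2 < #|[set i | [exists t' : tup k n, (t' \in T) && (t' i == t i)]]|)%N].

(* Each coordinate lying on T is rewarded by a factor n/|T|, so that members of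
   [covered T] get weight at least (n/|T|)^3. *)
Lemma card_covered T : (0 < #|T| <= n)%N ->
  #|covered T|%:R <= (#|T|%:R / n%:R) ^+ 3 * (2 * n%:R) ^+ k :> R.
Proof.
move=> /andP[T0 Tn]; have n0 : (0 < n)%N by apply: leq_trans Tn.
pose B (i : 'I_k) : {set 'I_n} := (fun t : tup k n => t i) @: T.
pose lam : R := n%:R / #|T|%:R.
have Tp : 0 < #|T|%:R :> R by rewrite ltr0n.
have np : 0 < n%:R :> R by rewrite ltr0n.
have lam1 : 1 <= lam by rewrite ler_pdivlMr // mul1r ler_nat.
have lam0 : 0 < lam by apply: lt_le_trans lam1.
have E : #|T|%:R / n%:R = lam^-1 by rewrite invf_div.
rewrite E exprVn mulrC ler_pdivlMr ?exprn_gt0 //.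
pose wt i v : R := if v \in B i then lam else 1.
apply: (@le_trans _ _ (\sum_(t : tup k n) \prod_i wt i (t i))).
  rewrite -sum1_card natr_sum big_distrl /= [leLHS]big_mkcond /=; apply: ler_sum => t _.
  case: ifP => [|_]; last first.
    by rewrite prodr_ge0 // => i _; rewrite /wt; case: ifP => _; rewrite ?ler01 ?ltW.
  rewrite inE mul1r; set S := [set _ | _] => S3.
  rewrite (bigID (mem S)) /= [X in _ * X]big1 ?mulr1; last first.
    move=> i; rewrite inE => iS; rewrite /wt; case: ifP => // /imsetP[t' t'T e].
    by case/negP: iS; apply/existsP; exists t'; rewrite t'T -e /=.
  rewrite (eq_bigr (fun=> lam)); last first.
    move=> i; rewrite inE => /existsP[t' /andP[t'T /eqP e]]; rewrite /wt -e.
    by rewrite /B; rewrite (imset_f (fun t : tup k n => t i)).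
  by rewrite prodr_const ler_weXn2l.
rewrite -(bigA_distr_bigA wt) -[X in _ <= _ ^+ X](card_ord k) -prodr_const.
apply: ler_prod => i _; rewrite sumr_ge0 /=; last first.
  by move=> v _; rewrite /wt; case: ifP => _; rewrite ?ler01 ?ltW.
(* In one coordinate, at most |T| values have weight n / |T| and at most n have weight 1, for a
   total of at most 2n. *)
rewrite (bigID (mem (B i))) /= (eq_bigr (fun=> lam)); last by move=> v vB; rewrite /wt vB.
rewrite [X in _ + X](eq_bigr (fun=> 1)); last by move=> v /negbTE vB; rewrite /wt vB.
rewrite sumr_const [X in _ + X]sumr_const mulr2n mulrDl mul1r; apply: lerD.
  rewrite -[leLHS]mulr_natr /lam mulrAC ler_pdivrMr // ler_wpM2l // ler_nat.
  exact: leq_imset_card.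
by rewrite ler_nat -[X in (_ <= X)%N](card_ord n) max_card.
Qed.

Variable mu : {ffun Zk N k -> R}.
Hypothesis mu_distr : is_distr mu.
Hypothesis mu_van : vanishing (phi mu).
Let ed2 := fun _ : bool => ed.
Let mu2 := fun _ : bool => mu.

Lemma prT_neq0 T : prT R m ed T != 0 -> {in T &, forall t u : tup k n, t != u -> forall i, t i != u i}.
Proof.
rewrite mulf_eq0 negb_or pnatr_eq0 cards_eq0 => /andP[/set0Pn[M]].
rewrite inE => /andP[/(MsetP _ ed_inj)[_ dM] TM] _ t u tT uT.
by apply: dM; apply: (subsetP TM).
Qed.

(** When [prT] is nonzero the tuples of [f true] are pairwise disjoint, so all their shared vertices
    must come from [f false]. *)
Lemma bad_covered (f : {ffun bool -> {set tup k n}}) :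
  prT R m ed (f true) != 0 -> bad ed2 f -> f true \subset covered (f false).
Proof.
move=> /prT_neq0 disj /forallP bf; apply/subsetP => t tf; rewrite inE.
have /implyP /(_ tf) := bf (true, t); move=> /leq_trans; apply.
apply: subset_leq_card; apply/subsetP => i; rewrite !inE /= => /existsP[[b t'] /and3P[/= tb ne]].
rewrite mem_vset // => /eqP e; apply/existsP; exists t'.
case: b tb ne => tb ne; last by rewrite tb e /=.
have tt' : t' != t by apply: contraNneq ne => ->.
by have := disj _ _ tb tf tt' i; rewrite e eqxx.
Qed.

(** Sum first over the copy covered by the other: there are at most C(|covered|, a) choices, each of
    probability at most beta^a. The powers n^k from [card_covered] and [beta] cancel, which leaves a
    gain of order (m/n)^2 (a/n) per tuple. *)
Lemma sum_fweight_two a : (0 < a)%N -> (m * 2 ^ (20 + k) <= n)%N -> (0 < n)%N ->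
  \sum_(f : {ffun bool -> {set tup k n}} | [forall b, #|f b| == a])
    fweight R m ed2 f <= ((2 : R) ^+ (20 * a))^-1.
Proof.
move=> a0 mn n0.
have m2n : (m.*2 <= n)%N.
  apply: leq_trans mn; rewrite -muln2 leq_mul2l; apply/orP; right.
  by rewrite expnD (_ : 2 ^ 20 = 2 * 2 ^ 19)%N // -mulnA leq_pmulr // muln_gt0 !expn_gt0.
have np : 0 < n%:R :> R by rewrite ltr0n.
have bt0 : 0 <= beta R k n m.
  by rewrite /beta divr_ge0 ?exprn_ge0 // mulr_ge0 // exprn_ge0.
have prT0 T := prT_ge0 R m ed T.
apply: (@le_trans _ _ (\sum_(f : {ffun bool -> {set tup k n}} | [forall b, #|f b| == a])
   prT R m ed (f false) * ((f true \subset covered (f false))%:R * (4 * beta R k n m) ^+ a))).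
  apply: ler_sum => f /forallP fa; rewrite /fweight big_bool /=.
  rewrite (eqP (fa true)) (eqP (fa false)) {1 2}/ed2 /=.
  have rhs0 : 0 <= prT R m ed (f false) *
      ((f true \subset covered (f false))%:R * (4 * beta R k n m) ^+ a).
    by rewrite mulr_ge0 // mulr_ge0 // exprn_ge0 // mulr_ge0.
  have [->|pt] := eqVneq (prT R m ed (f true)) 0; first by rewrite !mul0r mulr0.
  case: (boolP (bad ed2 f)) => [bf|_]; last by rewrite mul0r.
  rewrite (bad_covered pt bf).
  rewrite !mul1r (_ : 4 * beta R k n m = 2 * 2 * beta R k n m); last by ring.
  rewrite [(2 * 2 * _) ^+ a]exprMn [(2 * 2) ^+ a]exprMn.
  rewrite [leLHS](_ : _ = prT R m ed (f false) * (2 ^+ a * 2 ^+ a * prT R m ed (f true))); last by ring.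
  rewrite ler_wpM2l // ler_wpM2l ?mulr_ge0 ?exprn_ge0 //.
  by have := prT_le R ed_inj (f true) m2n n0; rewrite (eqP (fa true)).
rewrite (reindex (fun p : {set tup k n} * {set tup k n} =>
   [ffun b : bool => if b then p.1 else p.2])) /=; last first.
  exists (fun f => (f true, f false)) => [[T T'] _|f _] /=; first by rewrite !ffunE.
  by apply/ffunP => -[]; rewrite ffunE.
under eq_bigr => p _ do rewrite !ffunE.
rewrite (eq_bigl (fun p : {set tup k n} * {set tup k n} => (#|p.2| == a) && (#|p.1| == a))); last first.
  move=> p; apply/forallP/andP => [H|[H1 H2] b]; last by rewrite ffunE; case: b.
  by have := H true; have := H false; rewrite !ffunE => -> ->.
rewrite (eq_bigl (fun p : {set tup k n} * {set tup k n} => (#|p.1| == a) && (#|p.2| == a))); last first.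
  by move=> p; rewrite andbC.
rewrite -(pair_big (fun T => #|T| == a) (fun T => #|T| == a) (fun T T' =>
  prT R m ed T' * ((T \subset covered T')%:R * (4 * beta R k n m) ^+ a))) /=.
rewrite exchange_big /=.
pose c : R := (a%:R / n%:R) ^+ 3 * (2 * n%:R) ^+ k.
have c0 : 0 <= c by rewrite mulr_ge0 ?exprn_ge0 ?divr_ge0 ?mulr_ge0.
have b40 : 0 <= (4 * beta R k n m) ^+ a by rewrite exprn_ge0 // mulr_ge0.
(* No matching of size m contains more than m tuples; below, a <= m turns a/n into at most m/n. *)
have [am|ma] := leqP a m; last first.
  rewrite [leLHS]big1 ?invr_ge0 ?exprn_ge0 // => T' cT'.
  rewrite (_ : prT R m ed T' = 0) ?big1 // => [T _|]; first by rewrite mul0r.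
  apply/eqP; rewrite mulf_eq0 pnatr_eq0 cards_eq0; apply/orP; left.
  apply/eqP/setP => M; rewrite !inE; apply/negP => /andP[/andP[/eqP cM _] /subset_leq_card].
  by rewrite cM (eqP cT') leqNgt ma.
have an : (a <= n)%N by apply: (leq_trans am); lia.
apply: (@le_trans _ _ (\sum_(T' : {set tup k n} | #|T'| == a)
    prT R m ed T' * ((4 * c / a%:R) ^+ a * (4 * beta R k n m) ^+ a))).
  apply: ler_sum => T' /eqP cT'; rewrite -big_distrr /= ler_wpM2l // -big_distrl /=.
  rewrite ler_wpM2r // -natr_sum -big_mkcondr /= sum1dep_card.
  have h : #|covered T'|%:R <= c by rewrite /c -cT' card_covered // cT' a0.
  apply: le_trans (bin_le_pow a0 h).
  by rewrite ler_nat -cards_draws subset_leq_card //; apply/subsetP => T; rewrite !inE andbC.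
rewrite -big_distrl /=.
apply: (le_trans (ler_wpM2r _ (sum_prT R n m ed a))).
  by rewrite mulr_ge0 // exprn_ge0 // divr_ge0 // mulr_ge0.
apply: (le_trans (ler_wpM2r _ (bin_le_pow a0 (lexx m%:R)))).
  by rewrite mulr_ge0 // exprn_ge0 // divr_ge0 // mulr_ge0.
rewrite -!exprMn exprM -exprVn lerXn2r ?nnegrE ?invr_ge0 ?exprn_ge0 //.
  have x1 : 0 <= 4 * m%:R / a%:R :> R by rewrite divr_ge0 // mulr_ge0.
  have x2 : 0 <= 4 * c / a%:R by rewrite divr_ge0 // mulr_ge0.
  have x3 : 0 <= 4 * beta R k n m by rewrite mulr_ge0.
  by apply: mulr_ge0 => //; apply: mulr_ge0.
pose r : R := m%:R / n%:R; pose s := 2 ^+ k * r.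
have ap : 0 < a%:R :> R by rewrite ltr0n.
have r0 : 0 <= r by rewrite divr_ge0.
have s0 : 0 <= s by rewrite mulr_ge0 // exprn_ge0.
have ar : a%:R / n%:R <= r by rewrite ler_wpM2r ?invr_ge0 // ler_nat.
have rs : r <= s by rewrite ler_peMl // exprn_ege1 // ler1n.
have s20 : s <= (2 ^+ 20)^-1.
  rewrite /s /r mulrA ler_pdivrMr // [leRHS]mulrC ler_pdivlMr ?exprn_gt0 //.
  by move: mn; rewrite -(ler_nat R) natrM natrX exprD; apply: le_trans; rewrite le_eqVlt; apply/orP; left; apply/eqP; ring.
(* With a/n <= s this is at most 64 s^3, hence at most s because s <= 1/8, and s <= 2^(-20). *)
have -> : 4 * m%:R / a%:R * (4 * c / a%:R * (4 * beta R k n m)) = 64 * (s * s * (a%:R / n%:R)).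
  rewrite /c /s /r /beta [(2 * n%:R) ^+ k]exprMn.
  have nk0 : n%:R ^+ k != 0 :> R by rewrite expf_neq0 // gt_eqF.
  move: (2 ^+ k) (n%:R ^+ k) nk0 => A B nk0; field.
  by rewrite nk0 !gt_eqF.
have s8 : s <= 8^-1.
  apply: (le_trans s20); rewrite lef_pV2 ?posrE ?exprn_gt0 //.
  by rewrite -natrX ler_nat.
apply: le_trans s20.
have h1 : s * s * (a%:R / n%:R) <= s * s * s.
  by apply: ler_wpM2l; [exact: mulr_ge0|exact: le_trans ar rs].
nra.
Qed.

(** The second moment of the level is the average of a product over two copies of the player,
    bounded by [sum_fweight_two]; passing to the first moment halves the exponent 20 a. *)
Lemma avg_norm_level (w : Ytype k n N -> R) a :
  (forall y, 0 <= w y <= 1) -> (0 < a)%N -> (m * 2 ^ (20 + k) <= n)%N -> (0 < n)%N ->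
  avg (fun x : Xtype V n N => `|vpart m ed2 mu2 w (fun T => #|T| == a) true x|)
    <= ((2 : R) ^+ (10 * a))^-1.
Proof.
move=> w01 a0 mn n0; set g := vpart _ _ _ _ _ _.
rewrite -(@ler_pXn2r _ 2) ?nnegrE ?invr_ge0 ?exprn_ge0 //; last first.
  by rewrite -(avg_cst 0 (card_X_gt0 n N V)); apply: ler_avg.
apply: (le_trans (avg_norm_sqr _ (card_X_gt0 n N V))).
rewrite exprVn -exprM -mulnA (mulnC a) mulnA -[(10 * 2)%N]/20%N.
apply: le_trans (sum_fweight_two a0 mn n0).
have H := avg_prod_vpart m N_gt1 (fun _ : bool => ed_inj) (fun=> mu_distr)
  (fun=> mu_van) (w := fun=> w) (fun=> [pred T : {set tup k n} | #|T| == a]) (fun=> w01).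
apply: le_trans H.
apply: le_trans (ler_norm _); rewrite le_eqVlt; apply/orP; left; apply/eqP.
by apply: eq_avg => x; rewrite big_bool expr2.
Qed.

End TwoCopies.

(** * Counting the families in which every tuple shares three vertices *)

Lemma exists_superset (T : finType) (A : {set T}) w : (#|A| <= w <= #|T|)%N ->
  exists2 W : {set T}, A \subset W & #|W| = w.
Proof.
move=> /andP[]; elim: w => [|w IH] Aw wT.
  by exists A => //; apply/eqP; rewrite -leqn0.
move: Aw; rewrite leq_eqVlt => /orP[/eqP E|Aw]; first by exists A.
have [W AW cW] := IH Aw (ltnW wT).
have /card_gt0P[z] : (0 < #|~: W|)%N by rewrite cardsCs setCK cW subn_gt0.
rewrite inE => zW; exists (z |: W); last by rewrite cardsU1 zW cW.
by apply: (subset_trans AW); apply: subsetUr.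
Qed.

Lemma geometric_le (R : realType) (x : R) n : 0 <= x <= 1 / 2 ->
  \sum_(i < n) x ^+ i.+1 <= 2 * x.
Proof.
move=> /andP[x0 x1].
have H l : \sum_(i < l) x ^+ i <= 2.
  elim: l => [|l IH]; first by rewrite big_ord0.
  rewrite big_ord_recl expr0 (eq_bigr (fun i : 'I_l => x * x ^+ i)) //; last first.
    by move=> i _; rewrite -exprS.
  rewrite -big_distrr /=; nra.
rewrite (eq_bigr (fun i : 'I_n => x * x ^+ i)); last by move=> i _; rewrite exprS.
by rewrite -big_distrr /= [leLHS]mulrC ler_wpM2r ?H.
Qed.

Section BadFamilies.
Variables (R : realType) (k n N m : nat) (V J : finType) (ed : J -> {ffun 'I_k -> V}).
Hypothesis ed_inj : forall j, injective (ed j).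
Local Notation Fj := {ffun J -> {set tup k n}}.
Implicit Types (f : Fj) (W : {set V * 'I_n}).

Definition tuples f : {set J * tup k n} := [set z | z.2 \in f z.1].

Definition verts f : {set V * 'I_n} := \bigcup_(z in tuples f) vset (ed z.1) z.2.

Lemma tuples_inj : injective tuples.
Proof.
move=> f g E; apply/ffunP => j; apply/setP => t.
by have := congr1 (fun Z : {set J * tup k n} => (j, t) \in Z) E; rewrite /= !inE.
Qed.

Lemma card_tuples f : #|tuples f| = (\sum_j #|f j|)%N.
Proof.
transitivity #|[set z : J * tup k n | xpredT z.1 && (z.2 \in f z.1)]|.
  by apply: eq_card => z; rewrite !inE.
rewrite (card_sigma xpredT (fun j t => t \in f j)); apply: eq_bigr => j _.
by apply: eq_card => t; rewrite inE.
Qed.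

(* A vertex carrying an unshared incidence is charged to it, any other vertex
   carries two incidences. *)
Lemma card_verts_bad f : bad ed f -> (2 * #|verts f| + 3 * #|tuples f| <= 2 * (k * #|tuples f|))%N.
Proof.
move=> bf.
pose I := [set u : (J * tup k n) * 'I_k | (u.1 \in tuples f) && xpredT u.2].
pose U := [set u : (J * tup k n) * 'I_k | (u.1 \in tuples f) && (u.2 \notin shared ed f u.1)].
pose nu (u : (J * tup k n) * 'I_k) := (ed u.1.1 u.2, u.1.2 u.2).
have cI : #|I| = (k * #|tuples f|)%N.
  rewrite /I (card_sigma (mem (tuples f)) (fun _ => xpredT)) mulnC -sum_nat_const.
  by apply: eq_bigr => z _; rewrite cardsE card_ord.
have cU : (#|U| + 3 * #|tuples f| <= k * #|tuples f|)%N.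
  rewrite /U (card_sigma (mem (tuples f)) (fun z i => i \notin shared ed f z)).
  rewrite mulnC (mulnC k) -!sum_nat_const -big_split; apply: leq_sum => z zf.
  have b : (2 < #|shared ed f z|)%N.
    have : z \in tuples f by []; rewrite inE; exact: (implyP (forallP bf z)).
  by rewrite -[X in (_ <= X)%N](card_ord k) -(cardsC (shared ed f z)) [X in (_ <= X)%N]addnC leq_add //.
have nuv u : u \in I -> nu u \in verts f.
  rewrite inE andbT => uf; apply/bigcupP; exists u.1 => //.
  by rewrite mem_vset // eqxx.
(* [I] holds all incidences, k per tuple, and [U] the unshared ones, at most k - 3 per tuple. *)
suff : (2 * #|verts f| <= #|I| + #|U|)%N by move: cU; rewrite cI; lia.
rewrite mulnC -sum_nat_const -[#|I|]sum1_card -[#|U|]sum1_card.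
rewrite (partition_big nu (mem (verts f))) //= [X in (_ + X)%N](partition_big nu (mem (verts f))) /=; last first.
  by move=> u; rewrite inE => /andP[uf _]; apply: nuv; rewrite inE uf.
rewrite -big_split; apply: leq_sum => v /bigcupP[z zf /imsetP[i _ ev]] /=.
have zi : ((z, i) \in I) && (nu (z, i) == v) by rewrite inE zf ev eqxx.
rewrite (bigD1 (z, i)) //=.
case: (boolP (i \in shared ed f z)) => sh; last first.
  have zu : ((z, i) \in U) && (nu (z, i) == v) by rewrite inE zf sh ev /nu /=.
  by rewrite [X in (_ + X)%N](bigD1 (z, i)) //=; lia.
move: sh; rewrite inE => /existsP[z' /and3P[z'f zz' /imsetP[i' _ E]]].
rewrite (bigD1 (z', i')) /=; first by lia.
rewrite xpair_eqE (negbTE zz') andbT inE /= andbT inE z'f ev /nu /= E //.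
Qed.

Definition inside W : {set J * tup k n} := [set z | vset (ed z.1) z.2 \subset W].

Lemma card_inside W : (#|inside W| <= #|J| * #|W| ^ k)%N.
Proof.
have -> : #|inside W| = (\sum_(j : J) #|[set t : tup k n | vset (ed j) t \subset W]|)%N.
  rewrite -(card_sigma xpredT (fun j (t : tup k n) => vset (ed j) t \subset W)).
  by apply: eq_card => z; rewrite !inE.
rewrite -sum_nat_const; apply: leq_sum => j _.
rewrite -[X in (_ <= _ ^ X)%N](card_ord k) -card_ffun_on.
pose g (t : tup k n) : {ffun 'I_k -> V * 'I_n} := [ffun i => (ed j i, t i)].
rewrite -(card_imset _ (_ : injective g)).
  apply: subset_leq_card; apply/subsetP => h /imsetP[t]; rewrite inE => /subsetP tW ->.
  by apply/ffun_onP => i; rewrite ffunE tW // mem_vset.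
move=> t u /ffunP E; apply/ffunP => i; have := E i; rewrite !ffunE; by case.
Qed.

(** A family is determined by its tuples. Pad its vertex set to a set [W] of exactly [w] vertices,
    so that one binomial counts [W] and another the choice of [j] tuples inside it. *)
Lemma card_bad_families j w : (w <= #|V| * n)%N ->
  (forall f, bad ed f -> #|tuples f| = j -> (#|verts f| <= w)%N) ->
  (#|[set f : Fj | bad ed f && (#|tuples f| == j)]| <= 'C(#|V| * n, w) * 'C(#|J| * w ^ k, j))%N.
Proof.
move=> wX bw.
have cX : #|{: V * 'I_n}| = (#|V| * n)%N by rewrite card_prod card_ord.
rewrite -cX -card_draws -sum_nat_const -sum1dep_card.
apply: (@leq_trans (\sum_(f : Fj | bad ed f && (#|tuples f| == j))
   \sum_(W in [set W : {set V * 'I_n} | #|W| == w])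
     ((tuples f \subset inside W) && (#|tuples f| == j)))).
  apply: leq_sum => f /andP[bf /eqP tj].
  have [W fW cW] : exists2 W : {set V * 'I_n}, verts f \subset W & #|W| = w.
    by apply: exists_superset; rewrite bw // cX.
  rewrite (bigD1 W) /=; last by rewrite inE cW.
  rewrite tj eqxx andbT (_ : tuples f \subset _) //.
  apply/subsetP => z zf; rewrite inE; apply: subset_trans fW.
  exact: (bigcup_sup z).
rewrite exchange_big /=; apply: leq_sum => W; rewrite inE => /eqP cW.
rewrite -big_mkcondr /=.
apply: (@leq_trans #|tuples @: [set f : Fj | (tuples f \subset inside W) && (#|tuples f| == j)]|).
  rewrite card_imset; last exact: tuples_inj.
  rewrite sum1dep_card; apply: subset_leq_card; apply/subsetP => f; rewrite !inE.
  by case/andP.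
apply: (@leq_trans #|[set Z : {set J * tup k n} | Z \subset inside W & #|Z| == j]|).
  apply: subset_leq_card; apply/subsetP => Z /imsetP[f]; rewrite !inE => H ->; exact: H.
by rewrite cards_draws -cW leq_bin2l // card_inside.
Qed.

End BadFamilies.

(** The factors come, in order, from the choice of the vertices (w <= k j), the choice of the
    tuples, the constant in 2 [beta], and w / j <= k. *)
Definition bad_const k v q : nat := (4 * v) ^ k * (4 * q) * (2 * 2 ^ k) * k.

Lemma bad_count_le (R : realType) (k n m q v j w D : nat) :
  (0 < j)%N -> (0 < w)%N -> (0 < v)%N -> (0 < D)%N -> (m <= n)%N ->
  (k * j * D ^ 2 <= n)%N -> (2 * w + 3 * j <= 2 * (k * j))%N ->
  'C(v * n, w)%:R * 'C(q * w ^ k, j)%:R * (2 * beta R k n m) ^+ j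
    <= ((bad_const k v q)%:R / D%:R) ^+ j :> R.
Proof.
move=> j0 w0 v0 D0 mn kjn wj.
(* The surplus of powers of n: after cancellation a factor (w/n)^e remains, with 2 e >= j and w/n <=
   D^(-2), hence at most D^(-j). *)
pose e := (k * j - w - j)%N.
have kjE : (k * j = w + e + j)%N by rewrite /e; lia.
have je : (j <= 2 * e)%N by rewrite /e; lia.
have wk : (w <= k * j)%N by lia.
have D2 : (0 < D ^ 2)%N by rewrite expn_gt0 D0.
have n0 : (0 < n)%N by apply: leq_trans kjn; rewrite muln_gt0 D2 andbT; lia.
have [np wp jp Dp] : [/\ 0 < n%:R :> R, 0 < w%:R :> R, 0 < j%:R :> R & 0 < D%:R :> R].
  by rewrite !ltr0n.
have b0 : 0 <= beta R k n m by rewrite /beta divr_ge0 ?exprn_ge0 // mulr_ge0 // exprn_ge0.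
pose b' : R := n%:R * 2 ^+ k / n%:R ^+ k.
have bb' : 2 * beta R k n m <= 2 * b'.
  by rewrite ler_wpM2l // ler_wpM2r ?invr_ge0 ?exprn_ge0 // ler_wpM2r ?exprn_ge0 // ler_nat.
apply: (@le_trans _ _ ((4 * (v * n)%:R / w%:R) ^+ w * (4 * (q * w ^ k)%:R / j%:R) ^+ j
    * (2 * b') ^+ j)).
  have b20 : 0 <= 2 * beta R k n m by rewrite mulr_ge0.
  apply: ler_pM; [by rewrite mulr_ge0|exact: exprn_ge0| |].
    by apply: ler_pM => //; apply: bin_le_pow.
  by apply: lerXn2r bb'; rewrite nnegrE mulr_ge0 // divr_ge0 ?mulr_ge0 ?exprn_ge0.
have -> : (4 * (v * n)%:R / w%:R) ^+ w * (4 * (q * w ^ k)%:R / j%:R) ^+ j * (2 * b') ^+ j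
   = (4 * v%:R) ^+ w * (4 * q%:R) ^+ j * (2 * 2 ^+ k) ^+ j
     * (w%:R / j%:R) ^+ j * (w%:R / n%:R) ^+ e.
  have nk : (n%:R ^+ k) ^+ j = n%:R ^+ w * n%:R ^+ e * n%:R ^+ j :> R.
    by rewrite -exprM kjE !exprD.
  have wk' : (w%:R ^+ k) ^+ j = w%:R ^+ w * w%:R ^+ e * w%:R ^+ j :> R.
    by rewrite -exprM kjE !exprD.
  rewrite /b' !natrM natrX.
  have -> : 4 * (v%:R * n%:R) / w%:R = (4 * v%:R) * n%:R * w%:R^-1 :> R by rewrite mulrA.
  have -> : 4 * (q%:R * w%:R ^+ k) / j%:R = (4 * q%:R) * w%:R ^+ k * j%:R^-1 :> R by rewrite mulrA.
  have -> : 2 * (n%:R * 2 ^+ k / n%:R ^+ k) = (2 * 2 ^+ k) * n%:R * (n%:R ^+ k)^-1 :> R by ring.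
  rewrite ![(_ * _) ^+ _]exprMn ![(_^-1) ^+ _]exprVn nk wk'.
  have [a1 a2 a3 a4] : [/\ n%:R ^+ w != 0 :> R, n%:R ^+ e != 0 :> R, n%:R ^+ j != 0 :> R
     & w%:R ^+ w != 0 :> R] by rewrite !expf_neq0 ?gt_eqF.
  have a5 : j%:R ^+ j != 0 :> R by rewrite expf_neq0 ?gt_eqF.
  move: (n%:R ^+ w) (n%:R ^+ e) (n%:R ^+ j) (w%:R ^+ w) (j%:R ^+ j) a1 a2 a3 a4 a5.
  move=> x1 x2 x3 x4 x5 a1 a2 a3 a4 a5.
  move: (w%:R ^+ e) (w%:R ^+ j) => y1 y2; move: ((2 ^+ k) ^+ j) => y3.
  move: (4 ^+ w) (4 ^+ j) (2 ^+ j) (v%:R ^+ w) (q%:R ^+ j) => y4 y5 y6 y7 y8.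
  field.
  by rewrite a1 a2 a3 a4 a5.
have c1 : (w%:R / j%:R) ^+ j <= k%:R ^+ j :> R.
  rewrite lerXn2r ?nnegrE ?divr_ge0 // ler_pdivrMr // -natrM ler_nat //.
have c2 : (w%:R / n%:R) ^+ e <= (D%:R^-1) ^+ j :> R.
  apply: (@le_trans _ _ ((D%:R ^+ 2)^-1 ^+ e)).
    rewrite lerXn2r ?nnegrE ?divr_ge0 ?invr_ge0 ?exprn_ge0 //.
    rewrite ler_pdivrMr // mulrC ler_pdivlMr ?exprn_gt0 // -natrX -natrM ler_nat.
    by apply: leq_trans kjn; rewrite leq_mul2r wk orbT.
  rewrite exprVn -exprM -exprVn ler_wiXn2l ?invr_ge0 //.
  by rewrite invf_le1 // ler1n.
have c3 : (4 * v%:R) ^+ w <= ((4 * v%:R) ^+ k) ^+ j :> R.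
  by rewrite -exprM ler_weXn2l // -natrM ler1n muln_gt0.
have -> : (bad_const k v q)%:R / D%:R =
   (4 * v%:R) ^+ k * (4 * q%:R) * (2 * 2 ^+ k) * k%:R * D%:R^-1 :> R.
  by rewrite /bad_const !natrM natrX natrX natrM.
rewrite [leRHS]exprMn [(_ * k%:R) ^+ j]exprMn [(_ * (2 * 2 ^+ k)) ^+ j]exprMn.
rewrite [(_ * (4 * q%:R)) ^+ j]exprMn.
have p1 : 0 <= (4 * v%:R) ^+ w :> R by rewrite exprn_ge0 // mulr_ge0.
have p2 : 0 <= (4 * q%:R) ^+ j :> R by rewrite exprn_ge0 // mulr_ge0.
have p3 : 0 <= (2 * 2 ^+ k) ^+ j :> R by rewrite exprn_ge0 // mulr_ge0 // exprn_ge0.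
have p4 : 0 <= (w%:R / j%:R) ^+ j :> R by rewrite exprn_ge0 // divr_ge0.
have p5 : 0 <= (w%:R / n%:R) ^+ e :> R by rewrite exprn_ge0 // divr_ge0.
apply: ler_pM => //; first by do 3?apply: mulr_ge0.
apply: ler_pM => //; first by do 2?apply: mulr_ge0.
apply: ler_pM => //; first by apply: mulr_ge0.
by apply: ler_pM.
Qed.

Section BadSum.
Variables (R : realType) (k n m : nat) (V J : finType) (ed : J -> {ffun 'I_k -> V}).
Hypothesis ed_inj : forall j, injective (ed j).
Variables (s : J -> nat).
Let D := (100 * (bad_const k #|V| #|J|).+1)%N.
Local Notation Fj := {ffun J -> {set tup k n}}.

(** Families are grouped by their number of tuples. The factor 100 in [D] bounds the group of size l
    by 100^(-l), and the geometric series sums to at most 2/100. *)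
Lemma sum_fweight_le :
  (0 < #|V|)%N -> (m.*2 <= n)%N -> (0 < n)%N -> (k * (\sum_j s j) * D ^ 2 <= n)%N ->
  \sum_(f : Fj | [forall j, (#|f j| <= s j)%N] && (f != [ffun=> set0])) fweight R m ed f
  <= 1 / 50%:R.
Proof.
move=> v0 mn n0 sD; set S := (\sum_j s j)%N in sD.
have b0 : 0 <= beta R k n m by rewrite /beta divr_ge0 ?exprn_ge0 // mulr_ge0 // exprn_ge0.
(* The thresholds add up to [S], so [inord] loses nothing; level 0 holds only the excluded empty
   family. *)
pose lev (f : Fj) : 'I_S.+1 := inord #|tuples f|.
rewrite (partition_big lev xpredT) //= big_ord_recl /= big1 ?add0r; last first.
  move=> f /andP[/andP[/forallP sf f0] /eqP E].
  case/negP: f0; apply/eqP/ffunP => j; rewrite ffunE; apply/eqP; rewrite -cards_eq0.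
  have := congr1 val E; rewrite /= inordK.
    by rewrite card_tuples => /eqP; rewrite sum_nat_eq0 => /forallP/(_ j).
  by rewrite ltnS card_tuples leq_sum.
apply: (@le_trans _ _ (\sum_(l < S) (100^-1 : R) ^+ l.+1)); last first.
  by apply: le_trans (geometric_le _ _) _; lra.
apply: ler_sum => l _.
apply: (@le_trans _ _ (\sum_(f : Fj | bad ed f && (#|tuples f| == l.+1)) (2 * beta R k n m) ^+ l.+1)).
  rewrite [leLHS]big_mkcond [leRHS]big_mkcond; apply: ler_sum => f _.
  case: ifP => [/andP[/andP[/forallP sf _] /eqP E]|_]; last first.
    by case: ifP => // _; rewrite exprn_ge0 // mulr_ge0.
  have tl : #|tuples f| = l.+1.
    have := congr1 val E; rewrite /= inordK; first by move=> ->.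
    by rewrite ltnS card_tuples leq_sum.
  rewrite tl eqxx andbT /fweight; case: ifP => _; last by rewrite mul0r.
  rewrite mul1r -tl card_tuples.
  rewrite (_ : _ ^+ _ = \prod_j (2 * beta R k n m) ^+ #|f j|); last by rewrite prodrXr.
  apply: ler_prod => j _; rewrite mulr_ge0 ?prT_ge0 ?exprn_ge0 //=.
  by rewrite mulrC [(2 * _) ^+ _]exprMn ler_wpM2l ?exprn_ge0 // prT_le.
rewrite sumr_const -[leLHS]mulr_natl.
have -> : #|[pred f : Fj | bad ed f && (#|tuples f| == l.+1)]| =
  #|[set f : Fj | bad ed f && (#|tuples f| == l.+1)]| by apply: eq_card => f; rewrite inE.
have [->|/set0Pn[f]] := eqVneq [set f : Fj | bad ed f && (#|tuples f| == l.+1)] set0.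
  by rewrite cards0 mul0r exprn_ge0 ?invr_ge0.
rewrite inE => /andP[bf /eqP tf].
have k3 : (2 < k)%N.
  have /card_gt0P[z zf] : (0 < #|tuples f|)%N by rewrite tf.
  have : (2 < #|shared ed f z|)%N by move: zf; rewrite inE; apply: (implyP (forallP bf z)).
  by move=> /leq_trans; apply; rewrite -[X in (_ <= X)%N](card_ord k) max_card.
(* The largest vertex count allowed by [card_verts_bad]; it is positive since a nonempty bad family
   forces k >= 3. *)
pose w := (2 * (k * l.+1) - 3 * l.+1)./2.
have hw1 : (2 * w + 3 * l.+1 <= 2 * (k * l.+1))%N by rewrite /w; nia.
have hw2 (x : nat) : (2 * x + 3 * l.+1 <= 2 * (k * l.+1))%N -> (x <= w)%N by rewrite /w; lia.
have w0 : (0 < w)%N by apply: hw2; nia.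
have klD : (k * l.+1 * D ^ 2 <= n)%N.
  by apply: leq_trans sD; rewrite leq_mul2r leq_mul2l ltn_ord !orbT.
have D0 : (0 < D)%N by rewrite /D.
have wn : (w <= #|V| * n)%N.
  apply: leq_trans (leq_pmull _ v0); apply: leq_trans klD.
  by apply: leq_trans (leq_pmulr _ _); [lia|rewrite expn_gt0 D0].
have card_le : (#|[set f : Fj | bad ed f && (#|tuples f| == l.+1)]| <=
    'C(#|V| * n, w) * 'C(#|J| * w ^ k, l.+1))%N.
  apply: card_bad_families => // g bg tg; apply: hw2; rewrite -tg.
  exact: card_verts_bad.
apply: (@le_trans _ _ ('C(#|V| * n, w)%:R * 'C(#|J| * w ^ k, l.+1)%:R * (2 * beta R k n m) ^+ l.+1)).
  apply: ler_wpM2r; first by rewrite exprn_ge0 // mulr_ge0.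
  by rewrite -natrM ler_nat.
have mn' : (m <= n)%N by lia.
apply: (le_trans (bad_count_le R #|J| _ w0 v0 D0 mn' klD hw1)) => //.
rewrite lerXn2r ?nnegrE ?divr_ge0 ?invr_ge0 // ler_pdivrMr ?ltr0n //.
by rewrite /D natrM mulKf ?pnatr_eq0 // ler_nat.
Qed.

End BadSum.

(** * The crude bound on low parts, and switching players one at a time *)

Section Approximation.
Variables (R : realType).

Lemma sum_bin_le (x : R) m l : 0 <= x ->
  \sum_(a < l) 'C(m, a)%:R * x ^+ a <= (1 + x) ^+ m.
Proof.
move=> x0; elim: m l => [|m IH] [|l].
- by rewrite big_ord0.
- rewrite big_ord_recl big1 ?addr0 ?bin0 ?mulr1 // => i _.
  by rewrite bin0n mul0r.
- by rewrite big_ord0 exprn_ge0 // addr_ge0.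
rewrite big_ord_recl /= bin0 expr0 mulr1.
rewrite (eq_bigr (fun a : 'I_l => 'C(m, a.+1)%:R * x ^+ a.+1 + x * ('C(m, a)%:R * x ^+ a))); last first.
  by move=> a _; rewrite /bump leq0n add1n binS natrD exprS; ring.
rewrite big_split /= -big_distrr /=.
have := IH l.+1; rewrite big_ord_recl /= bin0 expr0 mulr1 => h1.
have {h1} h1 : 1 + \sum_(a < l) 'C(m, a.+1)%:R * x ^+ a.+1 <= (1 + x) ^+ m.
  by apply: le_trans h1; rewrite lerD2l; apply: ler_sum => a _; rewrite /bump leq0n add1n.
have := ler_wpM2l x0 (IH l); rewrite exprS mulrDl mul1r; move: h1; lra.
Qed.

(** By induction (1 + x)^d (1 - d x) <= 1; at d = D the second factor is 1/2. *)
Lemma bernoulli_upper (D : nat) : (0 < D)%N -> (1 + (2 * D%:R)^-1) ^+ D <= 2 :> R.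
Proof.
move=> D0; set x := (2 * D%:R)^-1 : R.
have Dp : 0 < D%:R :> R by rewrite ltr0n.
have x0 : 0 <= x by rewrite invr_ge0 mulr_ge0.
have H d : (1 + x) ^+ d * (1 - d%:R * x) <= 1.
  elim: d => [|d IH]; first by rewrite mul0r subr0 mulr1.
  apply: le_trans IH; rewrite exprSr -mulrA ler_wpM2l ?exprn_ge0 ?addr_ge0 //.
  have d0 : 0 <= d%:R :> R by [].
  rewrite -natr1; nra.
have := H D; have -> : D%:R * x = 1 / 2 by rewrite /x; field; rewrite gt_eqF.
lra.
Qed.

Definition low_mass (m s : nat) : R := \sum_(a < s.+1) 'C(m, a)%:R * 2 ^+ a.

(* The Chernoff trick with parameter 1/(4D). *)
Lemma low_mass_le (n m D s : nat) : (0 < D)%N -> (m <= n)%N ->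
  (s <= n %/ (4 * D * D))%N -> low_mass m s <= 2 ^+ (2 * (n %/ D)).+1.
Proof.
move=> D0 mn sn.
have Dp : 0 < D%:R :> R by rewrite ltr0n.
pose x : R := (2 * D%:R)^-1.
have x0 : 0 <= x by rewrite invr_ge0 mulr_ge0.
have D1 : 1 <= 4 * D%:R :> R by rewrite -natrM ler1n muln_gt0.
apply: (@le_trans _ _ ((4 * D%:R) ^+ s * (1 + x) ^+ m)).
  apply: le_trans (ler_wpM2l _ (sum_bin_le m s.+1 x0)); last by rewrite exprn_ge0 // mulr_ge0.
  rewrite big_distrr /=; apply: ler_sum => a _.
  rewrite mulrCA ler_wpM2l // (_ : 2 = 4 * D%:R * x); last by rewrite /x; field; rewrite gt_eqF.
  rewrite exprMn ler_wpM2r ?exprn_ge0 // ler_weXn2l //.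
  by rewrite -ltnS.
(* The first share pays for (4D)^s, through 4D < 2^(4D); the second pays for (1 + x)^m, through m <=
   D (n/D + 1) with the rounded quotient. *)
have -> : (2 * (n %/ D)).+1 = ((n %/ D) + (n %/ D).+1)%N by lia.
rewrite exprD ler_pM ?exprn_ge0 ?mulr_ge0 ?addr_ge0 //.
  apply: (@le_trans _ _ (2 ^+ (4 * D * s))).
    by rewrite exprM lerXn2r ?nnegrE ?mulr_ge0 ?exprn_ge0 // -natrM -natrX ler_nat ltnW // ltn_expl.
  rewrite ler_weXn2l ?ler1n // leq_divRL //.
  by move: sn; rewrite leq_divRL ?muln_gt0 ?D0 //; lia.
apply: (@le_trans _ _ ((1 + x) ^+ (D * (n %/ D).+1))).
  rewrite ler_weXn2l ?lerDl //; apply: (leq_trans mn).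
  by rewrite mulnC ltnW // -ltn_divLR.
by rewrite exprM lerXn2r ?nnegrE ?exprn_ge0 ?addr_ge0 // bernoulli_upper.
Qed.

(** A telescoping sum in which players before the switched one keep [u], bounded by 1, and players
    after it already use [v]. Each error is thus multiplied only by the crude bounds of later
    players. *)
Lemma hybrid (X P : finType) (u v : P -> X -> R) (Lam eps : P -> R) (eta : R) (l : seq P) :
  (0 < #|X|)%N ->
  (forall p x, 0 <= u p x <= 1) -> (forall p x, `|v p x| <= Lam p) ->
  (forall p, avg (fun x => `|u p x - v p x|) <= eps p) ->
  (forall l1 p l2, l = l1 ++ p :: l2 -> eps p * \prod_(p' <- l2) Lam p' <= eta) ->
  avg (fun x => `|\prod_(p <- l) u p x - \prod_(p <- l) v p x|) <= (size l)%:R * eta.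
Proof.
move=> X0 u01 vL uv; elim: l => [|p l IH] sp.
  rewrite mul0r (eq_avg (h := fun=> 0)) ?avg_cst // => x.
  by rewrite !big_nil subrr normr0.
have L0 p' : 0 <= Lam p'.
  have /card_gt0P[x _] := X0; exact: le_trans (normr_ge0 _) (vL p' x).
apply: (@le_trans _ _ (avg (fun x => (\prod_(p' <- l) Lam p') * `|u p x - v p x| +
   `|\prod_(p <- l) u p x - \prod_(p <- l) v p x|))).
  apply: ler_avg => x; rewrite !big_cons.
  set a := \prod_(_ <- l) u _ _; set b := \prod_(_ <- l) v _ _.
  have -> : u p x * a - v p x * b = (u p x - v p x) * b + u p x * (a - b) by ring.
  apply: (le_trans (ler_normD _ _)); rewrite !normrM; apply: lerD.
    rewrite mulrC ler_wpM2r // /b normr_prod.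
    by apply: ler_prod => p' _; rewrite normr_ge0 vL.
  have /andP[u0 u1] := u01 p x.
  by rewrite ler_piMl // ger0_norm.
rewrite avgD avgZ -natr1 mulrDl mul1r addrC; apply: lerD.
  by apply: IH => l1 p' l2 e; apply: (sp (p :: l1)); rewrite e.
apply: le_trans (sp [::] p l erefl); rewrite mulrC ler_wpM2r //.
by rewrite prodr_ge0.
Qed.

End Approximation.

(** * Full ratio, low part and tail of one player on a set of its inputs *)

Section PlayerBounds.
Variables (R : realType) (k n N m : nat) (V J : finType).
Variables (ed : J -> {ffun 'I_k -> V}) (mu : J -> {ffun Zk N k -> R}).
Hypothesis N_gt1 : (1 < N)%N.
Hypothesis ed_inj : forall j, injective (ed j).
Hypothesis mu_distr : forall j, is_distr (mu j).
Hypothesis mu_van : forall j, vanishing (phi (mu j)).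
Variables (w : Ytype k n N -> R) (j : J).
Hypothesis w01 : forall y, 0 <= w y <= 1.
Local Notation X := (Xtype V n N).
Local Notation upto s := (fun T : {set tup k n} => #|T| <= s)%N.

Lemma vpart_full x : vpart m ed mu w xpredT j x = \sum_y Pker (ed j) m (mu j) x y * w y.
Proof.
by apply: eq_bigr => y _; rewrite PkerE // mulrAC.
Qed.

Lemma vpart_full01 x : 0 <= vpart m ed mu w xpredT j x <= 1.
Proof.
rewrite vpart_full sumr_ge0 /=; last first.
  by move=> y _; have /andP[w0 _] := w01 y; rewrite mulr_ge0 // Pker_ge0.
apply: (@le_trans _ _ (\sum_y Pker (ed j) m (mu j) x y)); last exact: Pker_sum_le1.
apply: ler_sum => y _.
by have /andP[_ w1] := w01 y; rewrite ler_piMr // Pker_ge0.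
Qed.

Lemma vpart_upto_le s x : `|vpart m ed mu w (upto s) j x| <= low_mass R m s.
Proof.
apply: (@le_trans _ _ (\sum_(T : {set tup k n} | (#|T| <= s)%N) prT R m (ed j) T * 2 ^+ #|T|)).
  apply: (@le_trans _ _ (\sum_(T : {set tup k n} | (#|T| <= s)%N)
     \sum_y pno R m (ed j) y * ((T \subset supp y)%:R * `|mono (ed j) (phi (mu j)) T x y|))).
    rewrite exchange_big /=; apply: (le_trans (ler_norm_sum _ _ _)); apply: ler_sum => y _.
    have /andP[w0 w1] := w01 y.
    rewrite normrM -big_distrr /= ler_pM //.
      by rewrite ger0_norm ?mulr_ge0 ?pno_ge0 // ler_piMr ?pno_ge0.
    apply: (le_trans (ler_norm_sum _ _ _)); rewrite big_mkcondr /=.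
    by apply: ler_sum => T _; case: ifP => _; rewrite ?mul1r ?mul0r.
  by apply: ler_sum => T _; apply: sum_abs_mono.
rewrite (partition_big (fun T : {set tup k n} => inord #|T| : 'I_s.+1) xpredT) //= /low_mass.
apply: ler_sum => a _; apply: (@le_trans _ _ (\sum_(T : {set tup k n} | #|T| == a) prT R m (ed j) T * 2 ^+ a)).
  rewrite [leLHS](eq_bigl (fun T : {set tup k n} => #|T| == a)); last first.
    move=> T; case: leqP => sT; rewrite /= -?val_eqE /= ?inordK //.
    by apply/esym/negbTE; rewrite neq_ltn (leq_ltn_trans _ sT) ?orbT // -ltnS.
  by apply: ler_sum => T /eqP ->.
by rewrite -big_distrl /= ler_wpM2r ?exprn_ge0 // sum_prT.
Qed.

Lemma vpart_levels (P : pred nat) x :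
  vpart m ed mu w (fun T => P #|T|) j x =
  \sum_(a < m.+1 | P a) vpart m ed mu w (fun T => #|T| == a) j x.
Proof.
rewrite /vpart exchange_big /=; apply: eq_bigr => y _.
rewrite -big_distrr /=; have [yO|yO] := boolP (y \in Omega (ed j) n N m); last first.
  by rewrite /pno (negbTE yO) !mul0r.
congr (_ * _); rewrite /lpart.
rewrite (partition_big (fun T : {set tup k n} => inord #|T| : 'I_m.+1) (fun a : 'I_m.+1 => P a)) /=.
  apply: eq_bigr => a Pa; apply: eq_bigl => T.
  case sT: (T \subset supp y); rewrite ?andbF ?andbT // -val_eqE /= inordK.
    by case: eqP => [->|]; rewrite ?Pa ?andbF.
  by rewrite ltnS -(supp_card yO) subset_leq_card.
move=> T /andP[PT sT]; rewrite inordK //.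
by rewrite ltnS -(supp_card yO) subset_leq_card.
Qed.

(** A level a > s has mean at most 2^(-10 a) <= 2^(-5 s) 2^(-5 a), and the numbers 2^(-5 a) with a
    >= 1 sum to less than 1. *)
Lemma avg_vpart_tail s : (m * 2 ^ (20 + k) <= n)%N -> (0 < n)%N ->
  avg (fun x : X => `|vpart m ed mu w xpredT j x - vpart m ed mu w (upto s) j x|)
  <= (2 ^+ (5 * s))^-1.
Proof.
move=> mn n0.
apply: (@le_trans _ _ (avg (fun x : X =>
  \sum_(a < m.+1 | ~~ (a <= s)%N) `|vpart m ed mu w (fun T => #|T| == a) j x|))).
  apply: ler_avg => x; rewrite (vpart_levels xpredT) (vpart_levels (fun a => a <= s)%N).
  rewrite (bigID (fun a : 'I_m.+1 => (a <= s)%N)) /= addrAC subrr add0r.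
  exact: ler_norm_sum.
rewrite avg_sum.
apply: (@le_trans _ _ (\sum_(a < m.+1 | ~~ (a <= s)%N)
   (2 ^+ (5 * s))^-1 * ((2 ^+ 5)^-1) ^+ a)).
  apply: ler_sum => a; rewrite -ltnNge => sa.
  have a0 : (0 < a)%N by apply: leq_ltn_trans sa.
  have lev : avg (fun x : X => `|vpart m ed mu w (fun T => #|T| == a) j x|) <= (2 ^+ (10 * a))^-1.
    exact: (avg_norm_level N_gt1 (@ed_inj j) (mu_distr j) (@mu_van j) w01 a0 mn n0).
  apply: (le_trans lev).
  rewrite -exprVn -exprVn -exprVn -exprM -exprD ler_wiXn2l ?invr_ge0 ?invf_le1 ?ler1n //.
  lia.
rewrite -big_distrr /= -[leRHS]mulr1 ler_wpM2l ?invr_ge0 ?exprn_ge0 //.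
rewrite big_mkcond big_ord_recl /= add0r.
apply: (@le_trans _ _ (\sum_(i < m) ((2 ^+ 5)^-1 : R) ^+ i.+1)).
  by apply: ler_sum => i _; case: ifP => // _; rewrite exprn_ge0 // invr_ge0 exprn_ge0.
have x2 : 0 <= (2 ^+ 5 : R)^-1 <= 1 / 2.
  rewrite invr_ge0 exprn_ge0 // div1r lef_pV2 ?posrE ?exprn_gt0 //.
  by rewrite -natrX ler_nat.
by apply: (le_trans (geometric_le m x2)); move/andP: x2 => [_]; lra.
Qed.

End PlayerBounds.

(** * Leaves of a protocol: rectangles, and their number *)

Section Protocols.
Variables (k : nat) (E : finType) (K n N : nat) (Pi : protocol k E K n N).
Hypothesis Pi_wf : wf_protocol Pi.
Implicit Types (Y : Inputs k E K n N) (acc tr : seq bitseq).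
Local Notation step Y := (fun t p => rcons t (msg Pi p (Y p) t)).

Fixpoint consistent (sch : seq (E * 'I_K)) acc tr p (y : Ytype k n N) : bool :=
  match sch, tr with
  | q :: sch', b :: tr' =>
      ((q == p) ==> (msg Pi p y acc == b)) && consistent sch' (rcons acc b) tr' p y
  | _, _ => true
  end.

Fixpoint decode (sch : seq (E * 'I_K)) acc (bits : bitseq) : seq bitseq :=
  if sch is _ :: sch' then
    decode sch' (rcons acc (take (mlen Pi acc) bits)) (drop (mlen Pi acc) bits)
  else acc.

(** Since [mlen] depends on the transcript alone, the concatenated messages can be cut apart again.
    Trailing bits z are ignored, which later permits padding to a common length. *)
Lemma foldl_step Y sch acc : exists2 r, foldl (step Y) acc sch = acc ++ r &
  size r = size sch /\ forall z, decode sch acc (flatten r ++ z) = acc ++ r.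
Proof.
elim: sch acc => [|p sch IH] acc /=; first by exists [::]; rewrite ?cats0.
have [r -> [sr dr]] := IH (rcons acc (msg Pi p (Y p) acc)).
exists (msg Pi p (Y p) acc :: r); first by rewrite cat_rcons.
split=> [|z]; first by rewrite /= sr.
rewrite /= -catA -(Pi_wf p (Y p) acc) take_size_cat // drop_size_cat //.
by rewrite dr cat_rcons.
Qed.

(** The rectangle property: along a prescribed transcript, each message constrains the input of its
    speaker only. *)
Lemma foldl_step_eq Y sch acc r : size r = size sch ->
  (foldl (step Y) acc sch == acc ++ r) = [forall p, consistent sch acc r p (Y p)].
Proof.
elim: sch acc r => [|q sch IH] acc [|b r] //=.
  by rewrite cats0 eqxx => _; apply/esym/forallP.
move=> [sr]; have [eqb|neb] := eqVneq (msg Pi q (Y q) acc) b.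
  rewrite eqb -cat_rcons IH //; apply: eq_forallb => p.
  by case: eqVneq => //= <-; rewrite eqb eqxx.
have [r' -> [sr' _]] := foldl_step Y sch (rcons acc (msg Pi q (Y q) acc)).
rewrite cat_rcons eqseq_cat // eqxx /= eqseq_cons (negbTE neb).
by apply/esym/negbTE/forallPn; exists q; rewrite eqxx /= (negbTE neb).
Qed.

Lemma size_transcript Y : size (transcript Pi Y) = size (sched Pi).
Proof. by rewrite /transcript; have [r -> [-> _]] := foldl_step Y (sched Pi) [::]. Qed.

Lemma transcript_rectangle Y tr : size tr = size (sched Pi) ->
  (transcript Pi Y == tr) = [forall p, consistent (sched Pi) [::] tr p (Y p)].
Proof. exact: foldl_step_eq. Qed.

Lemma transcript_decode Y c : (sumn (map size (transcript Pi Y)) <= c)%N ->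
  exists t : c.-tuple bool, transcript Pi Y = decode (sched Pi) [::] t.
Proof.
rewrite /transcript; have [r -> [_ dr]] := foldl_step Y (sched Pi) [::]; rewrite cat0s => rc.
have st : size (flatten r ++ nseq (c - size (flatten r)) false) == c.
  by rewrite size_cat size_nseq subnKC // size_flatten.
by exists (Tuple st); rewrite dr.
Qed.

Variables (V : finType) (edge : E -> {ffun 'I_k -> V}) (m : nat).

(** Only valid inputs count, because [cost] bounds the length of their transcripts only. *)
Definition leaves : seq (seq bitseq) :=
  undup [seq transcript Pi Y | Y <- enum (validY edge m : pred (Inputs k E K n N))].

Lemma size_leaves : (size leaves <= 2 ^ cost edge m Pi)%N.
Proof.
have -> : (2 ^ cost edge m Pi)%N =
    size [seq decode (sched Pi) [::] (tval t) | t <- enum {: (cost edge m Pi).-tuple bool}].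
  by rewrite size_map -cardE card_tuple card_bool.
apply: uniq_leq_size; first exact: undup_uniq.
move=> tr; rewrite mem_undup => /mapP[Y]; rewrite mem_enum => vY ->.
have /transcript_decode[t ->] :
    (sumn (map size (transcript Pi Y)) <= cost edge m Pi)%N.
  exact: (@leq_bigmax_cond _ (validY edge m) (fun Y => sumn (map size (transcript Pi Y)))).
by apply: map_f; rewrite mem_enum.
Qed.

Lemma sum_leaves (R : realType) (g : Inputs k E K n N -> R) :
  (forall Y, ~~ validY edge m Y -> g Y = 0) ->
  \sum_(Y | run Pi Y) g Y = \sum_(tr <- leaves | pout Pi tr)
    \sum_Y (transcript Pi Y == tr)%:R * g Y.
Proof.
move=> g0; rewrite exchange_big /= big_mkcond; apply: eq_bigr => Y _.
have [vY|nvY] := boolP (validY edge m Y); last first.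
  by rewrite g0 // if_same big1 // => tr _; rewrite mulr0.
have Yl : transcript Pi Y \in leaves.
  by rewrite mem_undup; apply: map_f; rewrite mem_enum.
rewrite big_mkcond (bigD1_seq _ Yl (undup_uniq _)) /= eqxx mul1r big1 ?addr0 // => tr.
by rewrite eq_sym => /negbTE ->; rewrite mul0r if_same.
Qed.

End Protocols.

(** * From one leaf to the advantage of a protocol *)

Section Leaves.
Variables (R : realType) (k : nat) (V E : finType) (edge : E -> {ffun 'I_k -> V}).
Variables (N : nat) (mu : E -> {ffun Zk N k -> R}) (K n m : nat).
Hypothesis N_gt1 : (1 < N)%N.
Hypothesis edge_inj : forall e, injective (edge e).
Hypothesis mu_distr : forall e, is_distr (mu e).
Hypothesis mu_van : forall e, vanishing (phi (mu e)).
Local Notation P := (E * 'I_K)%type.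
Local Notation X := (Xtype V n N).
Let ed (p : P) := edge p.1.
Let nu (p : P) := mu p.1.
Variables (s : P -> nat) (eta : R).
Hypothesis mn : (m * 2 ^ (20 + k) <= n)%N.
Hypothesis n_gt0 : (0 < n)%N.
Hypothesis eta_ge0 : 0 <= eta.
Hypothesis s_eta : forall l1 p l2, index_enum P = l1 ++ p :: l2 ->
  (2 ^+ (5 * s p))^-1 * \prod_(p' <- l2) low_mass R m (s p') <= eta.

Let upto p := fun T : {set tup k n} => (#|T| <= s p)%N.

Definition defect (Y : Inputs k E K n N) : R :=
  `|avg (fun x : X => \prod_p lpart ed nu (upto p) p x (Y p)) - 1|.

(** The first error, from the tails, is paid once per leaf. The second keeps the weight of the leaf,
    so summing it over disjoint leaves does not multiply it by their number. *)
Lemma leaf_bound (w : P -> Ytype k n N -> R) : (forall p y, 0 <= w p y <= 1) ->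
  `|\sum_(Y : Inputs k E K n N) (\prod_p w p (Y p)) * (Pyes edge mu m Y - Pno R edge m Y)|
  <= #|{: P}|%:R * eta + \sum_(Y : Inputs k E K n N) (\prod_p w p (Y p)) * (Pno R edge m Y * defect Y).
Proof.
move=> w01.
have nuD p : is_distr (nu p) by exact: mu_distr.
have nuV p : vanishing (phi (nu p)) by exact: mu_van.
have edI p : injective (ed p) by exact: edge_inj.
pose u p (x : X) := vpart m ed nu (w p) xpredT p x.
pose v p (x : X) := vpart m ed nu (w p) (upto p) p x.
have yesE : \sum_(Y : Inputs k E K n N) (\prod_p w p (Y p)) * Pyes edge mu m Y
    = avg (fun x : X => \prod_p u p x).
  under [RHS]eq_avg => x.
    under eq_bigr => p _ do rewrite /u vpart_full //.
    rewrite bigA_distr_bigA /=; over.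
  rewrite /avg /= exchange_big /= big_distrr /=; apply: eq_bigr => Y _.
  rewrite /Pyes mulrCA; congr (_ * _); rewrite big_distrr; apply: eq_bigr => x _.
  by rewrite big_split /= mulrC.
have vE : avg (fun x : X => \prod_p v p x) = \sum_(Y : Inputs k E K n N)
    (\prod_p w p (Y p)) * (Pno R edge m Y * avg (fun x : X => \prod_p lpart ed nu (upto p) p x (Y p))).
  under [LHS]eq_avg => x do rewrite /v (prod_vpart m ed nu w upto x).
  rewrite avg_sum; apply: eq_bigr => Y _.
  by rewrite avgZ big_split /= mulrA [X in X * _]mulrC.
have -> : \sum_(Y : Inputs k E K n N) (\prod_p w p (Y p)) * (Pyes edge mu m Y - Pno R edge m Y)
   = avg (fun x : X => \prod_p u p x - \prod_p v p x) + \sum_(Y : Inputs k E K n N)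
    (\prod_p w p (Y p)) * (Pno R edge m Y *
       (avg (fun x : X => \prod_p lpart ed nu (upto p) p x (Y p)) - 1)).
  rewrite avgB -yesE vE; apply/eqP; rewrite -subr_eq0; apply/eqP.
  rewrite -sumrB -big_split -sumrB big1 // => Y _ /=; ring.
apply: (le_trans (ler_normD _ _)); apply: lerD.
  apply: (le_trans (ler_norm_avg _)).
  (* The switching follows the enumeration order of the players, the order in which [s_eta] is
     stated. *)
  rewrite cardT enumT -[Finite.enum _]/(index_enum P).
  apply: (hybrid (Lam := fun p => low_mass R m (s p)) (eps := fun p => (2 ^+ (5 * s p))^-1)) => //.
  - exact: card_X_gt0.
  - by move=> p x; exact: (vpart_full01 _ _ N_gt1 nuD p (w01 p)).
  - by move=> p x; exact: (vpart_upto_le _ _ N_gt1 nuD p (w01 p)).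
  - by move=> p; exact: (avg_vpart_tail N_gt1 edI nuD nuV p (w01 p) _ mn n_gt0).
apply: (le_trans (ler_norm_sum _ _ _)); apply: ler_sum => Y _.
have w0 : 0 <= \prod_p w p (Y p).
  by rewrite prodr_ge0 // => p _; have /andP[] := w01 p (Y p).
have p0 : 0 <= Pno R edge m Y by rewrite prodr_ge0 // => p _; apply: pno_ge0.
by rewrite !normrM (ger0_norm w0) (ger0_norm p0).
Qed.

Lemma adv_le (Pi : protocol k E K n N) : wf_protocol Pi ->
  adv edge mu m Pi <= (2 ^ cost edge m Pi)%:R * (#|{: P}|%:R * eta)
     + \sum_(Y : Inputs k E K n N) Pno R edge m Y * defect Y.
Proof.
move=> wf; rewrite /adv -sumrB.
have Pno_ge0 Y : 0 <= Pno R edge m Y by rewrite prodr_ge0 // => p _; apply: pno_ge0.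
have defect_ge0 Y : 0 <= defect Y by exact: normr_ge0.
have invalid (Y : Inputs k E K n N) : ~~ validY edge m Y ->
    Pyes edge mu m Y - Pno R edge m Y = 0.
  rewrite negb_forall => /existsP[p pY].
  rewrite /Pno (bigD1 p) //= (negbTE pY) mul0r subr0 /Pyes big1 ?mulr0 // => x _.
  by rewrite (bigD1 p) //= /Pker; move: pY; rewrite inE => /negbTE ->; rewrite mul0r.
rewrite (sum_leaves Pi invalid).
pose w tr p y : R := (consistent Pi (sched Pi) [::] tr p y)%:R.
have eta0 : 0 <= #|{: P}|%:R * eta by rewrite mulr_ge0.
apply: (@le_trans _ _ (\sum_(tr <- leaves Pi edge m) (#|{: P}|%:R * eta +
   \sum_(Y : Inputs k E K n N) (transcript Pi Y == tr)%:R * (Pno R edge m Y * defect Y)))).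
  apply: (le_trans (ler_norm_sum _ _ _)); rewrite big_mkcond /=.
  rewrite big_seq [leRHS]big_seq; apply: ler_sum => tr.
  rewrite mem_undup => /mapP[Y0 _ E0].
  have str : size tr = size (sched Pi) by rewrite E0 size_transcript.
  have wE Y : (transcript Pi Y == tr)%:R = \prod_p w tr p (Y p).
    rewrite (transcript_rectangle wf) // /w; case: (boolP [forall p, _]) => [/forallP H|].
      by rewrite big1 // => p _; rewrite H.
    by rewrite negb_forall => /existsP[p /negbTE pF]; rewrite (bigD1 p) //= pF mul0r.
  under eq_bigr => Y _ do rewrite wE.
  under [X in _ <= _ + X]eq_bigr => Y _ do rewrite wE.
  case: ifP => _; last first.
    rewrite addr_ge0 // sumr_ge0 // => Y _; rewrite mulr_ge0 ?mulr_ge0 //.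
    by rewrite prodr_ge0.
  apply: (@leaf_bound (w tr)) => p y; rewrite /w; by case: (consistent _ _ _ _ _ _); rewrite ?lexx ler01.
rewrite big_split /=; apply: lerD.
  rewrite big_const_seq count_predT iter_addr addr0 -[leLHS]mulr_natl.
  by rewrite ler_wpM2r // ler_nat size_leaves.
rewrite exchange_big /=; apply: ler_sum => Y _.
rewrite -big_distrl /= ler_piMl ?mulr_ge0 //.
(* The leaves are distinct, so the indicators for a given Y sum to at most 1. *)
have : uniq (leaves Pi edge m) by exact: undup_uniq.
elim: (leaves Pi edge m) => [|tr l IH] /=; first by rewrite big_nil.
move=> /andP[trl ul]; rewrite big_cons; case: eqP => [etr|_]; last by rewrite add0r IH.
rewrite big_seq big1 ?addr0 // => tr' trl'; case: eqP => // etr'.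
by move: trl; rewrite -etr etr' trl'.
Qed.

End Leaves.

(** * Choice of thresholds and numerical estimates *)

(** The step to 4 D^2 is what [low_mass_le] asks for, and the factor 4 (q + 1) in D leaves room for
    up to q later players. *)
Fixpoint scale (q D0 i : nat) : nat :=
  if i is i'.+1 then let D := (4 * q.+1 * scale q D0 i')%N in (4 * D * D)%N else D0.

Lemma scale_gt0 q D0 i : (0 < D0)%N -> (0 < scale q D0 i)%N.
Proof. by move=> D0p; elim: i => //= i IH; rewrite !muln_gt0 IH. Qed.

Lemma scale_le q D0 i j : (0 < D0)%N -> (i <= j)%N -> (scale q D0 i <= scale q D0 j)%N.
Proof.
move=> D0p; elim: j => [|j IH]; first by rewrite leqn0 => /eqP ->.
rewrite leq_eqVlt => /orP[/eqP -> //|/IH h]; apply: (leq_trans h) => /=.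
have := scale_gt0 q j D0p; nia.
Qed.

(* Later players get much smaller thresholds, so that their crude bound
   [low_mass] is absorbed by the tail of an earlier player. *)
Lemma scale_tail (R : realType) (P : finType) (D0 n m : nat) (l1 l2 : seq P) p :
  let s p' := (n %/ scale #|P| D0 (index p' (index_enum P)))%N in
  (0 < D0)%N -> (m <= n)%N -> index_enum P = l1 ++ p :: l2 ->
  (2 ^+ (5 * s p))^-1 * \prod_(p' <- l2) low_mass R m (s p')
    <= 2 ^+ #|P| * ((2 : R) ^+ (4 * (n %/ scale #|P| D0 #|P|)))^-1.
Proof.
move=> s D0p mn El; set q := #|P|.
have ul : uniq (l1 ++ p :: l2) by rewrite -El index_enum_uniq.
have sl : size (l1 ++ p :: l2) = q by rewrite -El /q cardT enumT.
have ip : index p (index_enum P) = size l1.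
  move: ul; rewrite El cat_uniq /= negb_or => /and3P[_ /andP[pl1 _] _].
  by rewrite index_cat (negbTE pl1) /= eqxx addn0.
pose D := scale q D0 (size l1); pose D' := (4 * q.+1 * D)%N.
have Dp : (0 < D)%N by apply: scale_gt0.
have sp : s p = (n %/ D)%N by rewrite /s ip.
have D'p : (0 < D')%N by rewrite !muln_gt0 Dp.
have low p' : p' \in l2 -> low_mass R m (s p') <= 2 ^+ (2 * (n %/ D')).+1.
  move=> p'l2; apply: (low_mass_le _ D'p mn); rewrite /s.
  have ip' : (size l1 < index p' (index_enum P))%N.
    move: ul; rewrite El cat_uniq => /and3P[_ h /= /andP[pl2 _]].
    rewrite index_cat; case: ifP => [p'l1|_ /=].
      by case/hasP: h; exists p' => //; rewrite inE p'l2 orbT.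
    by case: eqVneq => [e|_]; [rewrite e p'l2 in pl2|rewrite addnS ltnS leq_addr].
  by apply: leq_div2l => //; [exact: (scale_gt0 q (size l1).+1 D0p)|exact: (scale_le q D0p ip')].
(* At most q later players contribute an exponent 2 (n/D') + 1 each; the rounded quotients add up to
   at most n/D, and the ones to q. *)
have prod_le : \prod_(p' <- l2) low_mass R m (s p') <= 2 ^+ (s p + q).
  apply: (@le_trans _ _ (\prod_(p' <- l2) (2 : R) ^+ (2 * (n %/ D')).+1)).
    rewrite big_seq [leRHS]big_seq; apply: ler_prod => p' p'l2; rewrite low // andbT.
    by rewrite sumr_ge0 // => a _; rewrite mulr_ge0 // exprn_ge0.
  rewrite big_const_seq count_predT iter_mulr_1 -exprM ler_weXn2l ?ler1n //.
  have l2q : (size l2 <= q)%N by rewrite -sl size_cat /=; lia.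
  apply: (@leq_trans ((2 * (n %/ D')).+1 * q)); first by rewrite leq_mul2l l2q orbT.
  rewrite mulSn addnC leq_add2r sp leq_divRL //.
  have := leq_trunc_div n D'; rewrite /D'; move: (n %/ _)%N => t; nia.
have ss : (n %/ scale q D0 q <= s p)%N.
  rewrite sp; apply: leq_div2l => //; apply: scale_le => //.
  by rewrite -sl size_cat leq_addr.
apply: (le_trans (ler_wpM2l _ prod_le)); first by rewrite invr_ge0 exprn_ge0.
rewrite mulrC exprD [_ ^+ s p * _]mulrC -mulrA ler_wpM2l ?exprn_ge0 //.
(* One share of the tail exponent pays for the later players; the other four are kept against the
   number of leaves. *)
have -> : (5 * s p = s p + 4 * s p)%N by lia.
rewrite exprD invfM mulrA mulfV ?mul1r ?expf_neq0 //; last by rewrite pnatr_eq0.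
by rewrite lef_pV2 ?posrE ?exprn_gt0 // ler_weXn2l ?ler1n // leq_mul2l ss orbT.
Qed.

Lemma final_numerics (R : realType) (c q t : nat) : (c <= t)%N -> (2 * q + 4 <= t)%N ->
  (2 ^ c)%:R * (q%:R * (2 ^+ q * (2 ^+ (4 * t))^-1)) <= 16^-1 :> R.
Proof.
move=> ct qt.
have p0 x : 0 < (2 : R) ^+ x by rewrite exprn_gt0.
rewrite !mulrA ler_pdivrMr // natrX.
have -> : 16^-1 * 2 ^+ (4 * t) = 2 ^+ (4 * t - 4) :> R.
  have -> : (4 * t = (4 * t - 4) + 4)%N by lia.
  rewrite addnK exprD mulrCA -[RHS]mulr1; congr (_ * _).
  by rewrite -natrX mulVf ?pnatr_eq0.
apply: (@le_trans _ _ (2 ^+ c * 2 ^+ q * 2 ^+ q)).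
  rewrite ler_wpM2r ?exprn_ge0 // ler_wpM2l ?exprn_ge0 // -natrX ler_nat ltnW //.
  exact: ltn_expl.
by rewrite -!exprD ler_weXn2l ?ler1n //; lia.
Qed.

Lemma sixteenth_fiftieth_lt_tenth (R : realType) : 16^-1 + 1 / 50%:R < 1 / 10%:R :> R.
Proof. lra. Qed.

(** As N >= 2, the factor N^(10 k) in the bound on alpha is at least the 2^k required here. *)
Lemma alpha_density (R : realType) (k N v m n : nat) (alpha : R) :
  (1 < N)%N -> (0 < v)%N ->
  alpha <= ((2%:R ^+ 20) * (N%:R ^+ (10 * k)) * (v%:R ^+ 2))^-1 ->
  m%:R = alpha * n%:R -> (m * 2 ^ (20 + k) <= n)%N.
Proof.
move=> N1 v0 al mE; rewrite -(ler_nat R) natrM mE mulrAC natrX exprD.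
have vp : 0 < v%:R :> R by rewrite ltr0n.
have Np : 0 < N%:R :> R by rewrite ltr0n (ltn_trans _ N1).
rewrite -[leRHS]mul1r ler_wpM2r //.
apply: le_trans (ler_wpM2r _ al) _; first by rewrite mulr_ge0 ?exprn_ge0.
rewrite mulrC ler_pdivrMr ?mul1r ?mulr_gt0 ?exprn_gt0 // -mulrA ler_wpM2l ?exprn_ge0 //.
rewrite -[leLHS]mulr1 ler_pM ?exprn_ge0 //; last by rewrite exprn_ege1 // ler1n.
rewrite exprM; apply: (@le_trans _ _ (2 ^+ (10 * k))).
  by rewrite ler_weXn2l ?ler1n // leq_pmull.
by rewrite -exprM lerXn2r ?nnegrE // ler_nat.
Qed.

(** * Choice of gamma and of the smallest n *)

Unset Implicit Arguments. Set Strict Implicit. Set Printing Implicit Defensive.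

Theorem theorem7p1 (R : realType) (k : nat) (V E : finType)
  (edge : E -> {ffun 'I_k -> V}) (N : nat) (mu : E -> {ffun Zk N k -> R})
  (K : nat) (alpha : R) :
  dlgraph edge mu ->
  (0 < K)%N ->
  0 < alpha ->
  alpha <= ((2%:R ^+ 20) * (N%:R ^+ (10 * k)) * (#|V|%:R ^+ 2))^-1 ->
  (forall e, twowise (mu e)) ->
  exists gamma : R, 0 < gamma /\
    exists n0 : nat, forall n m : nat, (n0 <= n)%N -> m%:R = alpha * n%:R ->
      (* CC(G, n, alpha, K) >= gamma n, i.e. every protocol with
         advantage >= 0.1 has cost >= gamma n *)
      forall P : protocol k E K n N, wf_protocol P ->
        1 / 10%:R <= adv edge mu m P ->
        gamma * n%:R <= (cost edge m P)%:R.
Proof.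
move=> [edge_inj N_gt1 mu_distr mu_one] _ alpha_gt0 alpha_le mu_two.
(* For empty [V] the bound on alpha would be the inverse of 0, which is 0. *)
have V_gt0 : (0 < #|V|)%N.
  rewrite lt0n; apply: contraTneq alpha_le => ->.
  by rewrite expr0n mulr0 invr0 leNgt alpha_gt0.
have mu_van e : vanishing (phi (mu e)) by apply: phi_vanishing.
pose q := #|{: E * 'I_K}|.
(* [D1] is the constant of [sum_fweight_le], and [D0] keeps the sum of the q thresholds, each at
   most n/D0, within its hypothesis. *)
pose D1 := (100 * (bad_const k #|V| q).+1)%N.
pose D0 := (k.+1 * q.+1 * D1 ^ 2)%N.
have D0_gt0 : (0 < D0)%N by rewrite !muln_gt0.
pose D := scale q D0 q.
have D_gt0 : (0 < D)%N by apply: scale_gt0.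
exists (D%:R^-1); split; first by rewrite invr_gt0 ltr0n.
(* This makes n/D at least 2 q + 4, as [final_numerics] requires. By contraposition, a cost below
   n/D yields an advantage of at most 1/16 + 1/50. *)
exists (D * (2 * q + 4))%N => n m n_ge mE Pi Pi_wf; apply: contraTT.
rewrite -!ltNge mulrC ltr_pdivlMr ?ltr0n // -natrM ltr_nat => costD.
have cost_le : (cost edge m Pi <= n %/ D)%N by rewrite leq_divRL // ltnW.
have t_ge : (2 * q + 4 <= n %/ D)%N by rewrite leq_divRL // mulnC.
have n_gt0 : (0 < n)%N by apply: leq_trans n_ge; rewrite muln_gt0 D_gt0 addnS.
have mn := alpha_density N_gt1 V_gt0 alpha_le mE.
have m2n : (m.*2 <= n)%N.
  apply: leq_trans mn; rewrite -muln2 leq_mul2l; apply/orP; right.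
  by rewrite expnD (_ : 2 ^ 20 = 2 * 2 ^ 19)%N // -mulnA leq_pmulr // muln_gt0 !expn_gt0.
have m_le_n : (m <= n)%N by lia.
pose s (p : E * 'I_K) := (n %/ scale q D0 (index p (index_enum (E * 'I_K)%type)))%N.
pose eta : R := 2 ^+ q * (2 ^+ (4 * (n %/ D)))^-1.
have eta_ge0 : 0 <= eta by rewrite mulr_ge0 ?invr_ge0 ?exprn_ge0.
have s_eta l1 p l2 : index_enum (E * 'I_K)%type = l1 ++ p :: l2 ->
    (2 ^+ (5 * s p))^-1 * \prod_(p' <- l2) low_mass R m (s p') <= eta.
  by move=> El; apply: (scale_tail R D0_gt0 m_le_n El).
have sum_s : (k * (\sum_p s p) * D1 ^ 2 <= n)%N.
  have : (\sum_p s p <= q * (n %/ D0))%N.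
    rewrite -sum_nat_const; apply: leq_sum => p _; apply: leq_div2l => //.
    exact: (scale_le q D0_gt0 (leq0n _)).
  move=> sum_le; apply: leq_trans (leq_trunc_div n D0).
  rewrite -[X in (_ <= _ * X)%N]/(k.+1 * q.+1 * D1 ^ 2)%N [X in (_ <= X)%N]mulnA leq_mul2r; apply/orP; right.
  move: sum_le; move: (\sum_p _)%N (n %/ D0)%N => S t; nia.
have near1 : \sum_(Y : Inputs k E K n N) Pno R edge m Y * defect edge mu s Y <= 1 / 50%:R.
  apply: le_trans (sum_fweight_le R (fun p : E * 'I_K => edge_inj p.1) V_gt0 m2n n_gt0 sum_s).
  apply: (low_part_near1 m N_gt1 (fun p : E * 'I_K => edge_inj p.1)
    (fun p => mu_distr p.1) (fun p => mu_van p.1)) => p.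
  by rewrite cards0.
apply: le_lt_trans (adv_le N_gt1 edge_inj mu_distr mu_van mn n_gt0 eta_ge0 s_eta Pi_wf) _.
have cost_term : (2 ^ cost edge m Pi)%:R * (q%:R * eta) <= 16^-1 by exact: final_numerics.
by apply: (le_lt_trans (lerD cost_term near1)); exact: sixteenth_fiftieth_lt_tenth.
Qed.
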